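(* Let $\Sigma\subseteq N_{\mathbb{R}}$ be a simplicial $d$-fan, $*\in\mathrm{Inn}(N_{\mathbb{R}})$ an inner product, and $\omega:\Sigma(d)\rightarrow\mathbb{R}_{>0}$ a weight function. Then $$\mathrm{MVol}_{\Sigma,\omega,*}(z_1,\dots,z_d)\geq 0\quad\text{for all}\quad z_1,\dots,z_d\in\overline{\mathrm{Cub}}(\Sigma,* )$$ and $$\mathrm{MVol}_{\Sigma,\omega,*}(z_1,\dots,z_d)> 0\quad\text{for all}\quad z_1,\dots,z_d\in\mathrm{Cub}(\Sigma,* ).$$
   Context: **Fans.** $N_{\mathbb{R}}$ is a finite-dimensional real vector space. All fans are (finite) polyhedral fans that are pure (all maximal cones have the same dimension) and marked (a generator $0\neq u_\rho\in\rho$ is chosen for each ray $\rho$). A $d$-fan is such a fan of dimension $d$. $\Sigma(k)$ is the set of $k$-dimensional cones, $\sigma(1)$ the set of rays of $\sigma$, $\sigma^\circ$ the relative interior, $N_{\sigma,\mathbb{R}}$ the linear span of $\sigma$. $\Sigma$ is simplicial if $\dim N_{\sigma,\mathbb{R}}=|\sigma(1)|$ for all $\sigma\in\Sigma$. $\mathrm{Inn}(N_{\mathbb{R}})$ is the set of inner products on $N_{\mathbb{R}}$. **Cubical values.** For $z\in\mathbb{R}^{\Sigma(1)}$ and $\sigma\in\Sigma$, $w_{\sigma,*}(z)\in N_{\sigma,\mathbb{R}}$ is the unique vector with $w_{\sigma,*}(z)*u_\rho=z_\rho$ for all $\rho\in\sigma(1)$. $\mathrm{Cub}(\Sigma,*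 )$ (resp. $\overline{\mathrm{Cub}}(\Sigma,* )$) is the set of $z\in\mathbb{R}^{\Sigma(1)}$ with $w_{\sigma,*}(z)\in\sigma^\circ$ (resp. $w_{\sigma,*}(z)\in\sigma$) for all $\sigma\in\Sigma$. **Mixed volumes.** Let $P_{\sigma,*}(z)=\{v\in\sigma\mid v*u_\rho\le z_\rho\text{ for all }\rho\in\sigma(1)\}$. Let $M_\sigma\subseteq N_{\sigma,\mathbb{R}}$ be the lattice spanned by the basis dual to $\{u_\rho\mid\rho\in\sigma(1)\}$ with respect to $*$; $\mathrm{Vol}_\sigma$ is the volume on polytopes in $N_{\sigma,\mathbb{R}}$ normalized so that a fundamental simplex of $M_\sigma$ (convex hull of $0$ and a lattice basis) has volume $1$, and $\mathrm{MVol}_\sigma$ is the associated mixed volume of polytopes (symmetric, Minkowski-multilinear, $\mathrm{MVol}_\sigma(P,\dots,P)=\mathrm{Vol}_\sigma(P)$). For pseudocubical values, $$\mathrm{MVol}_{\Sigma,\omega,*}(z_1,\dots,z_d)=\sum_{\sigma\in\Sigma(d)}\omega(\sigma)\mathrm{MVol}_\sigma(P_{\sigma,*}(z_1),\dots,P_{\sigma,*}(z_d)).$$ *)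

(* Defs.v *)
From HB Require Import structures.
From mathcomp Require Import all_boot all_order all_algebra all_fingroup.
From mathcomp Require Import sesquilinear finmap.
From mathcomp Require Import all_classical all_reals all_analysis.

Set Implicit Arguments.
Unset Strict Implicit.
Unset Printing Implicit Defensive.

Import Order.TTheory GRing.Theory Num.Theory.

Local Open Scope classical_set_scope.
Local Open Scope ring_scope.

Section Hulls.
Context {R : realType} {V : vectType R}.
Implicit Types (s : seq V) (A C : set V).

Definition conic_hull s : set V :=
  [set \sum_(i < size s) a i *: s`_i |
     a in [set a : 'I_(size s) -> R | forall i, 0 <= a i]].

Definition convex_hull s : set V :=
  [set \sum_(i < size s) a i *: s`_i |
     a in [set a : 'I_(size s) -> R |
             (forall i, 0 <= a i) /\ \sum_(i < size s) a i = 1]].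

(* Polytopes are nonempty. *)
Definition is_polytope A := exists2 s, s != [::] & A = convex_hull s.

Definition lin_span A : {vspace V} :=
  xget 0%VS [set U : {vspace V} | A `<=` [set` U] /\
    forall W : {vspace V}, A `<=` [set` W] -> (U <= W)%VS].

Lemma lin_spanP A :
  A `<=` [set` lin_span A] /\
  forall W : {vspace V}, A `<=` [set` W] -> (lin_span A <= W)%VS.
Proof.
pose p n := `[< exists2 U : {vspace V}, A `<=` [set` U] & \dim U = n >].
have pex : exists n, p n.
  by exists (\dim {:V}); apply/asboolP; exists fullv => // x _ /=; exact: memvf.
case: (ex_minnP pex) => n /asboolP[U AU dU] nmin.
apply: (@xgetPex _ 0%VS [set U : {vspace V} | A `<=` [set` U] /\
    forall W : {vspace V}, A `<=` [set` W] -> (U <= W)%VS]).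
exists U; split => // W AW; apply/capv_idPl/eqP.
rewrite eqEdim capvSl /= dU; apply: nmin; apply/asboolP.
exists (U :&: W)%VS => // x Ax /=.
by rewrite memv_cap (AU x Ax) (AW x Ax).
Qed.

Definition cone_dim C : nat := \dim (lin_span C).

(* The topology of the span is the one given by the norm of ip; all norms on a
   finite-dimensional space define the same topology.  For a cone the linear
   span is also the affine span. *)
Definition relint (ip : {dot V for idfun}) C : set V :=
  [set v | C v /\ exists2 e : R, 0 < e &
     forall w, w \in lin_span C -> ip (w - v) (w - v) < e -> C w].

End Hulls.

Section Fans.
Context {R : realType} {V : vectType R}.
Implicit Types (C F : set V) (Sigma : set (set V)).

Definition polyhedral_cone C := exists s : seq V, C = conic_hull s.

Definition strongly_convex C := forall v, C v -> C (- v) -> v = 0.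

Definition is_face F C := exists2 f : {scalar V},
  forall v, C v -> 0 <= f v & F = C `&` [set v | f v = 0].

Record is_fan Sigma : Prop := IsFan {
  fan_finite : finite_set Sigma;
  fan_nonempty : Sigma !=set0;
  fan_polyhedral : forall C, Sigma C -> polyhedral_cone C;
  fan_strongly_convex : forall C, Sigma C -> strongly_convex C;
  fan_face : forall C F, Sigma C -> is_face F C -> Sigma F;
  fan_setI : forall C D, Sigma C -> Sigma D ->
    is_face (C `&` D) C /\ is_face (C `&` D) D
}.

Definition cones Sigma (k : nat) : set (set V) :=
  [set C | Sigma C /\ cone_dim C = k].

Definition pure Sigma (d : nat) := forall C, Sigma C ->
  (forall D, Sigma D -> C `<=` D -> D = C) -> cone_dim C = d.

Definition marking Sigma (u : set V -> V) :=
  forall rho, cones Sigma 1 rho -> rho (u rho) /\ u rho != 0.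

Definition marked_fan (d : nat) Sigma (u : set V -> V) :=
  [/\ is_fan Sigma, pure Sigma d & marking Sigma u].

Definition rays C : set (set V) := [set rho | is_face rho C /\ cone_dim rho = 1].

Definition simplicial Sigma :=
  forall C, Sigma C -> (rays C #= `I_(cone_dim C))%card.

End Fans.

Section MixedVolumes.
Context {R : realType} {V : vectType R}.
Implicit Types (A Q : set V) (b : seq V) (vol : set V -> R).

(* Lebesgue measure on R^n, as an iterated integral over the coordinates. *)
Fixpoint lebesgue_n (n : nat) : set (n.-tuple R) -> \bar R :=
  match n with
  | 0 => fun E => (\1_E [tuple])%:E
  | m.+1 => fun E =>
      (\int[lebesgue_measure]_(x in [set: R])
         lebesgue_n [set t : m.-tuple R | E [tuple of x :: t]])%E
  end.

Definition coord_volume b A : R :=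
  fine (lebesgue_n
    [set t : (size b).-tuple R | A (\sum_(i < size b) tnth t i *: b`_i)]).

(* For b a basis of a lattice M, the volume on the span of b for which a
   fundamental simplex of M has volume 1. *)
Definition normalized_volume b A : R :=
  coord_volume b A / coord_volume b (convex_hull (0 :: b)).

Definition polytope_in (U : {vspace V}) A := is_polytope A /\ A `<=` [set` U].

Record is_mixed_volume (U : {vspace V}) vol (d : nat)
    (MV : ('I_d -> set V) -> R) : Prop := IsMixedVolume {
  mixed_sym : forall (P : 'I_d -> set V) (s : 'S_d),
    (forall i, polytope_in U (P i)) -> MV (P \o s) = MV P;
  mixed_linear : forall (P : 'I_d -> set V) (i : 'I_d) Q Q' (a a' : R),
    (forall j, polytope_in U (P j)) ->
    polytope_in U Q -> polytope_in U Q' -> 0 <= a -> 0 <= a' ->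
    MV (dfwith P i [set a *: x + a' *: y | x in Q & y in Q']) =
    a * MV (dfwith P i Q) + a' * MV (dfwith P i Q');
  mixed_diag : forall Q, polytope_in U Q -> MV (fun=> Q) = vol Q
}.

Definition minkowski_sum (d : nat) (P : 'I_d -> set V) (I : {set 'I_d}) : set V :=
  [set \sum_(i in I) x i |
     x in [set x : 'I_d -> V | forall i, i \in I -> P i (x i)]].

Definition polarization vol (d : nat) (P : 'I_d -> set V) : R :=
  (d`!%:R)^-1 * \sum_(I : {set 'I_d}) (-1) ^+ (d - #|I|) * vol (minkowski_sum P I).

(* The mixed volume associated to vol.  By mixed_volumeE below it agrees on
   polytopes with the default value of xget, which is the only possible one;
   the default plays no role when vol is a volume, since a mixed volume exists
   by a theorem of Minkowski. *)
Definition mixed_volume (U : {vspace V}) vol (d : nat) :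
    ('I_d -> set V) -> R :=
  xget (@polarization vol d) [set MV | is_mixed_volume U vol MV].

Lemma convex_hull_comb (J : finType) (s : seq V) (a : J -> R) (y : J -> V) :
  (forall j, 0 <= a j) -> \sum_j a j = 1 -> (forall j, y j \in s) ->
  convex_hull s (\sum_j a j *: y j).
Proof.
move=> a0 a1 ys.
have ylt j : (index (y j) s < size s)%N by rewrite index_mem.
pose h j : 'I_(size s) := Ordinal (ylt j).
exists (fun i => \sum_(j | h j == i) a j); first split.
- by move=> i; apply: sumr_ge0.
- by rewrite -a1 (partition_big h xpredT).
- rewrite [RHS](partition_big h xpredT) //=; apply: eq_bigr => i _.
  rewrite scaler_suml; apply: eq_bigr => j /eqP <-.
  by rewrite /= nth_index.
Qed.

Lemma polytopeD Q Q' : is_polytope Q -> is_polytope Q' ->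
  is_polytope [set x + y | x in Q & y in Q'].
Proof.
move=> [s s0 ->] [t t0 ->].
exists [seq x + y | x <- s, y <- t].
  by case: s t s0 t0 => [|x s] [|y t].
rewrite eqEsubset; split => [_ [_ [a [a0 a1] <-] [_ [b [b0 b1] <-] <-]]|_ [c [c0 c1] <-]].
  have -> : \sum_(i < size s) a i *: s`_i + \sum_(i < size t) b i *: t`_i =
      \sum_(p : 'I_(size s) * 'I_(size t)) (a p.1 * b p.2) *: (s`_p.1 + t`_p.2).
    rewrite -(pair_bigA _ (fun i j => (a i * b j) *: (s`_i + t`_j)))/=.
    under [in RHS]eq_bigr => i _.
      under eq_bigr => j _ do rewrite scalerDr.
      rewrite big_split/=.
      over.
    rewrite big_split/=; congr (_ + _).
      by apply: eq_bigr => i _; rewrite -scaler_suml -mulr_sumr b1 mulr1.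
    rewrite exchange_big/=; apply: eq_bigr => j _.
    by rewrite -scaler_suml -mulr_suml a1 mul1r.
  apply: convex_hull_comb => [p||p]; first exact: mulr_ge0.
    rewrite -(pair_bigA _ (fun i j => a i * b j))/=.
    by under eq_bigr => i _ do rewrite -mulr_sumr b1 mulr1.
  by apply/allpairsP; exists (s`_p.1, t`_p.2); rewrite /= !mem_nth.
set r := [seq _ | _ <- _, _ <- _].
have /choice[xy xyP] (k : 'I_(size r)) :
    exists p : V * V, [/\ p.1 \in s, p.2 \in t & r`_k = p.1 + p.2].
  by have /allpairsP[p ?] : r`_k \in r by [apply: mem_nth]; exists p.
exists (\sum_k c k *: (xy k).1).
  by apply: convex_hull_comb => // k; case: (xyP k).
exists (\sum_k c k *: (xy k).2).
  by apply: convex_hull_comb => // k; case: (xyP k).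
rewrite -big_split/=; apply: eq_bigr => k _.
by rewrite -scalerDr; case: (xyP k) => _ _ ->.
Qed.

Lemma polytope_in0 (U : {vspace V}) : polytope_in U [set 0].
Proof.
split; last by move=> x /= ->; exact: mem0v.
exists [:: 0] => //; rewrite eqEsubset; split => [x /= ->|x [a _ <-]/=].
  exists (fun=> 1); last by rewrite big_ord1 /= scaler0.
  by split => [i|]; rewrite ?big_ord1.
by rewrite big_ord1 /= scaler0.
Qed.

Lemma minkowski_sum0 (d : nat) (P : 'I_d -> set V) :
  minkowski_sum P finset.set0 = [set 0].
Proof.
rewrite eqEsubset; split => [x [y _ <-]/=|x /= ->]; first by rewrite big_set0.
by exists (fun=> 0); rewrite ?big_set0 // => i; rewrite inE.
Qed.

Lemma minkowski_sumU1 (d : nat) (P : 'I_d -> set V) (i : 'I_d) (I : {set 'I_d}) :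
  i \notin I ->
  minkowski_sum P (i |: I)%SET = [set x + y | x in P i & y in minkowski_sum P I].
Proof.
move=> iI; rewrite eqEsubset; split => [_ [x xP <-]|_ [x Px [_ [y yP <-] <-]]].
  exists (x i); first by apply: xP; rewrite setU11.
  exists (\sum_(j in I) x j); last by rewrite big_setU1.
  by exists x => // j jI; apply: xP; rewrite in_setU1 jI orbT.
exists (dfwith y i x).
  move=> j; rewrite in_setU1; have [->|ji] := eqVneq j i.
    by rewrite dfwithin.
  by move=> /= jI; rewrite dfwithout 1?eq_sym//; exact: yP.
rewrite big_setU1//= dfwithin; congr (_ + _); apply: eq_bigr => j jI.
by rewrite dfwithout//; apply: contraNneq iI => ->.
Qed.

Lemma polytope_in_sum (U : {vspace V}) (d : nat) (P : 'I_d -> set V)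
    (I : {set 'I_d}) :
  (forall i, polytope_in U (P i)) -> polytope_in U (minkowski_sum P I).
Proof.
move=> PU; have [n] := ubnP #|I|; elim: n I => // n IHn I In.
have [->|[i iI]] := set_0Vmem I; first by rewrite minkowski_sum0; exact: polytope_in0.
rewrite -(finset.setD1K iI) minkowski_sumU1; last by rewrite finset.setD11.
have [pI sI] : polytope_in U (minkowski_sum P (I :\ i)%SET).
  by apply: IHn; rewrite (cardsD1 i I) iI /= in In.
have [pi si] := PU i.
split; first exact: polytopeD.
by move=> _ [x Px [y Py <-]] /=; apply: memvD; [exact: si|exact: sI].
Qed.

Section Uniqueness.
Context (U : {vspace V}) (vol : set V -> R) (d : nat) (MV : ('I_d -> set V) -> R).
Context (MVP : is_mixed_volume U vol MV).
Context (P : 'I_d -> set V) (PU : forall i, polytope_in U (P i)).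

Let mixed_sum (T : 'I_d -> set V) (k : 'I_d) (I : {set 'I_d}) :
  (forall i, polytope_in U (T i)) ->
  MV (dfwith T k (minkowski_sum P I)) = \sum_(j in I) MV (dfwith T k (P j)).
Proof.
move=> TU; have [n] := ubnP #|I|; elim: n I => // n IHn I In.
have [->|[i iI]] := set_0Vmem I.
  rewrite minkowski_sum0 big_set0.
  have := mixed_linear MVP k TU (TU k) (TU k) (lexx 0) (lexx 0).
  rewrite !mul0r addr0 => <-; congr (MV (dfwith _ _ _)).
  rewrite eqEsubset; split => [_ /= ->|_ [x _ [y _ <-]] /=].
    have [[s s0 ->] _] := TU k.
    have [x sx] : exists x, convex_hull s x.
      exists (\sum_(j : 'I_1) 1 *: s`_0); apply: convex_hull_comb => //.
        by rewrite big_ord1.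
      by move=> _; apply: mem_nth; case: s s0.
    by exists x => //; exists x => //; rewrite !scale0r addr0.
  by rewrite !scale0r addr0.
rewrite (big_setD1 i)//= -IHn; last by rewrite (cardsD1 i I) iI /= in In.
rewrite -{1}(finset.setD1K iI) minkowski_sumU1; last by rewrite finset.setD11.
have := mixed_linear MVP k TU (PU i) (polytope_in_sum (I :\ i)%SET PU) ler01 ler01.
rewrite !mul1r => <-; congr (MV (dfwith _ _ _)).
rewrite eqEsubset; split => _ [x Px [y Py <-]]; exists x => //; exists y => //.
  by rewrite !scale1r.
by rewrite !scale1r.
Qed.

Let mixed_expand (I : {set 'I_d}) (r : seq 'I_d) (f0 : {ffun 'I_d -> 'I_d}) :
  uniq r ->
  MV (fun k => if k \in r then minkowski_sum P I else P (f0 k)) =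
  \sum_(g : {ffun 'I_d -> 'I_d} |
      [forall k, if k \in r then g k \in I else g k == f0 k]) MV (P \o g).
Proof.
elim: r f0 => [|k r IHr] f0 /=.
  move=> _; rewrite (big_pred1 f0)// => g /=.
  by apply/forallP/eqP => [gf|-> //]; apply/ffunP => k; exact/eqP/gf.
move=> /andP[kr ur].
pose T i := if i \in r then minkowski_sum P I else P (f0 i).
have TU i : polytope_in U (T i).
  by rewrite /T; case: ifP => _; [exact: polytope_in_sum|exact: PU].
transitivity (MV (dfwith T k (minkowski_sum P I))).
  congr MV; apply/funext => i; rewrite in_cons.
  have [->|ik] := eqVneq i k; first by rewrite dfwithin.
  by rewrite dfwithout// eq_sym.
rewrite mixed_sum//.
rewrite [RHS](partition_big (fun g : {ffun 'I_d -> 'I_d} => g k) (mem I))/=; last first.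
  by move=> g /forallP/(_ k); rewrite mem_head.
apply: eq_bigr => j jI.
pose f1 := [ffun i => if i == k then j else f0 i].
transitivity (MV (fun i => if i \in r then minkowski_sum P I else P (f1 i))).
  congr MV; apply/funext => i; rewrite ffunE.
  have [->|ik] := eqVneq i k; first by rewrite dfwithin (negPf kr).
  by rewrite dfwithout// eq_sym.
rewrite IHr//; apply: eq_bigl => g; apply/forallP/andP => [gf|[/forallP gf /eqP gk] i].
  have gk : g k = j by have := gf k; rewrite (negPf kr) ffunE eqxx => /eqP.
  rewrite gk; split => //; apply/forallP => i; rewrite in_cons.
  have [->|ik] := eqVneq i k; first by rewrite gk.
  by have := gf i; rewrite ffunE (negPf ik).
have := gf i; rewrite in_cons ffunE.
by have [->|ik] := eqVneq i k; rewrite ?(negPf kr) ?gk ?eqxx.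
Qed.

Let sign_sum (J : {set 'I_d}) :
  \sum_(I : {set 'I_d} | J \subset I) (-1) ^+ (d - #|I|) =
    (J == finset.setT)%:R :> R.
Proof.
have [->|] := eqVneq J finset.setT.
  rewrite (big_pred1 finset.setT) => [|I]; last by rewrite finset.subTset.
  by rewrite cardsT card_ord subnn.
rewrite -finset.subTset => /subsetPn[j _ jJ] /=.
set S := LHS.
pose h (I : {set 'I_d}) := if j \in I then (I :\ j)%SET else (j |: I)%SET.
have hK : involutive h.
  move=> I; rewrite /h; case: (boolP (j \in I)) => jI.
    by rewrite finset.setD11 finset.setD1K.
  by rewrite setU11 finset.setU1K.
have hI I : (-1) ^+ (d - #|h I|) = - (-1) ^+ (d - #|I|) :> R.
  have cd (A : {set 'I_d}) : (#|A| <= d)%N by rewrite -[X in (_ <= X)%N]card_ord max_card.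
  have jI1 (A : {set 'I_d}) : j \in A ->
      (-1) ^+ (d - #|(A :\ j)%SET|) = - (-1) ^+ (d - #|A|) :> R.
    move=> jA; have := cd A; have -> : #|A| = #|(A :\ j)%SET|.+1.
      by rewrite (cardsD1 j A) jA.
    by move=> Ad; rewrite -(subnSK Ad) exprS mulN1r.
  rewrite /h; case: (boolP (j \in I)) => jI; first exact: jI1.
  have := jI1 (j |: I)%SET; rewrite setU11 finset.setU1K// => /(_ erefl) ->.
  by rewrite opprK.
have : S = - S.
  rewrite {1}/S (reindex_inj (inv_inj hK))/= -sumrN; apply: eq_big => I //.
  rewrite /h; case: ifP => jI; first by rewrite subsetD1 jJ andbT.
  by rewrite -[in RHS](finset.setU1K (negbT jI)) subsetD1 jJ andbT.
by move=> /eqP; rewrite -addr_eq0 -mulr2n mulrn_eq0 /= => /eqP.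
Qed.

Let imset_setTP (g : {ffun 'I_d -> 'I_d}) :
  ((g @: 'I_d)%SET == finset.setT) = injectiveb g.
Proof.
rewrite finset.eqEcard finset.subsetT/= cardsT.
apply/idP/injectiveP => [gI|g_inj]; last first.
  by rewrite card_imset.
have /imset_injP g_inj : #|(g @: 'I_d)%SET| == #|'I_d|.
  by rewrite eqn_leq gI leq_imset_card.
by move=> x y; apply: g_inj.
Qed.

Lemma mixed_volume_unique : MV P = polarization vol P.
Proof.
have MVI I : vol (minkowski_sum P I) =
    \sum_(g : {ffun 'I_d -> 'I_d} | (g @: 'I_d)%SET \subset I) MV (P \o g).
  rewrite -(mixed_diag MVP) ?polytope_in_sum//; last exact: polytope_in_sum.
  transitivity (MV (fun k => if k \in enum 'I_d then minkowski_sum P I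
                             else P ([ffun i => i] k))).
    by congr MV; apply/funext => k; rewrite mem_enum.
  rewrite mixed_expand ?enum_uniq//; apply: eq_bigl => g.
  apply/forallP/fintype.subsetP => [gI _ /imsetP[k _ ->]|gI k].
    by have := gI k; rewrite mem_enum.
  by rewrite mem_enum /=; apply: gI; apply: imset_f.
rewrite /polarization.
under eq_bigr => I _ do rewrite MVI mulr_sumr.
rewrite (exchange_big_dep xpredT)//=.
under eq_bigr => g _ do rewrite -mulr_suml sign_sum mulr_natl mulrb.
rewrite -big_mkcond/=.
rewrite (eq_bigr (fun=> MV P)) => [|g /eqP gT]; last first.
  have g_inj : injective g.
    by apply/injectiveP; rewrite -imset_setTP; apply/eqP.
  rewrite -(mixed_sym MVP (perm g_inj) PU); congr MV.
  by apply/funext => k /=; rewrite permE.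
rewrite sumr_const.
have -> : #|[pred g : {ffun 'I_d -> 'I_d} | (g @: 'I_d)%SET == finset.setT]| = d`!.
  rewrite -ffactnn -[in RHS](card_ord d) -card_inj_ffuns cardsE.
  by apply: eq_card => g; rewrite !inE imset_setTP.
by rewrite -[X in _ * X]mulr_natr mulrCA mulVf ?mulr1// pnatr_eq0 -lt0n fact_gt0.
Qed.

End Uniqueness.

Lemma mixed_volumeE (U : {vspace V}) vol (d : nat) (P : 'I_d -> set V) :
  (forall i, polytope_in U (P i)) ->
  mixed_volume U vol P = polarization vol P.
Proof.
move=> PU; rewrite /mixed_volume.
by case: xgetP => // MV _ /mixed_volume_unique; apply.
Qed.

End MixedVolumes.

Section NormalComplexes.
Context {R : realType} {V : vectType R}.
Context (ip : {dot V for idfun}) (u : set V -> V).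
Implicit Types (C : set V) (Sigma : set (set V)) (z : set V -> R).

(* An element of R^(Sigma(1)) is given by a function on all sets, of which only
   the values at the rays of Sigma are ever used; likewise for the markings u
   and, on maximal cones, for the weights omega. *)

Definition cubical_vec C z : V :=
  xget 0 [set w | w \in lin_span C /\ forall rho, rays C rho -> ip w (u rho) = z rho].

Definition Cub Sigma : set (set V -> R) :=
  [set z | forall C, Sigma C -> relint ip C (cubical_vec C z)].

Definition pseudoCub Sigma : set (set V -> R) :=
  [set z | forall C, Sigma C -> C (cubical_vec C z)].

Definition truncated_cone C z : set V :=
  [set v | C v /\ forall rho, rays C rho -> ip v (u rho) <= z rho].

(* The basis of the span of C dual to the u rho, which is a basis of the
   lattice M_C. *)
Definition dual_basis C : seq V :=
  [seq cubical_vec C \1_[set rho] | rho <- enum_fset (fset_set (rays C))].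

Definition cone_volume C : set V -> R := normalized_volume (dual_basis C).

Definition MVol_cone C (d : nat) : ('I_d -> set V) -> R :=
  mixed_volume (lin_span C) (cone_volume C) (d := d).

Definition MVol (d : nat) Sigma (omega : set V -> R) (z : 'I_d -> set V -> R) : R :=
  \sum_(C \in cones Sigma d)
    omega C * MVol_cone C (fun i => truncated_cone C (z i)).

End NormalComplexes.

(* Main.v *)
(* Write u_1, ..., u_n for the marked generators of a simplicial cone C and use
   the coordinates t_i = v * u_i, which are those of the dual basis.  For
   pseudocubical z the polytope P(z) = {v in C | v * u_i <= z_i} is the convex
   hull of the vectors w_tau, which are additive in z, so Minkowski sums of the
   P(z_j) are the P of the sums.  The facet v * u_i = z_i, projected orthogonally
   along u_i, is again of the form P(z') in dimension n - 1; cutting P(z) into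
   the pyramids with apex 0 over these facets gives
     n! Vol P(z) = sum_t prod_k l_(t,k)(z)
   over complete flags t of faces, with linear forms l_(t,k) that are nonnegative
   on pseudocubical and positive on cubical values.  Polarizing a product of
   linear forms yields a permanent, whence the sign of the mixed volume. *)
Require Import Defs.
From HB Require Import structures.
From mathcomp Require Import all_boot all_order all_algebra.
From mathcomp Require Import sesquilinear finmap.
From mathcomp Require Import all_classical all_reals all_analysis.
From mathcomp Require Import measurable_realfun.
From mathcomp Require Import ring zify.
Set Implicit Arguments.
Unset Strict Implicit.
Unset Printing Implicit Defensive.
Import Order.TTheory GRing.Theory Num.Theory numFieldNormedType.Exports.
Local Open Scope classical_set_scope.
Local Open Scope ring_scope.

(** * Truncated cones and their faces *)

(** The induction on the dimension leaves the fan, since the projections of the generators along one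
    of them need not span a cone of [Sigma]. The geometry is therefore done for arbitrary
    independent families [u : 'I_n -> V] with coefficient functions. Cubicality survives the
    projection because it is imposed on all faces: the faces containing generator i become all the
    faces of the projected family. Pseudocubicality enters twice. It forces the sign of the i-th
    coefficient on the facet v * u_i = z_i, so that this facet projects onto the whole truncated
    cone below. It also indexes the points w_tau of all P(z) by the same sets tau, which gives the
    harder inclusion for Minkowski sums. In the coordinates t_j = v * u_j truncation is
    coordinatewise and projection along u_i merely translates the remaining coordinates. The mixed
    volume is accessed through [mixed_volumeE] alone: once the P(z) are known to be polytopes, it is
    an alternating sum of volumes of Minkowski sums. *)

Section Insert.
Context {T : Type} {n : nat}.
Implicit Types (i : 'I_n.+1) (x : T) (f : 'I_n -> T).

Definition insert_at i x f (k : 'I_n.+1) : T :=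
  if unlift i k is Some j then f j else x.

Lemma insert_at_id i x f : insert_at i x f i = x.
Proof. by rewrite /insert_at unlift_none. Qed.

Lemma insert_at_lift i x f j : insert_at i x f (lift i j) = f j.
Proof. by rewrite /insert_at liftK. Qed.

End Insert.

Section InnerProduct.
Context {R : realFieldType} {V : lmodType R} (ip : {dot V for idfun}).

Lemma dotC v w : ip v w = ip w v.
Proof. by rewrite (hermC ip) expr0 mul1r. Qed.

Lemma dotZl a v w : ip (a *: v) w = a * ip v w.
Proof. exact: linearZl_LR. Qed.

Lemma dotZr a v w : ip v (a *: w) = a * ip v w.
Proof. by rewrite dotC dotZl dotC. Qed.

Lemma dotDl v v' w : ip (v + v') w = ip v w + ip v' w.
Proof. exact: linearDl. Qed.

Lemma dotBl v v' w : ip (v - v') w = ip v w - ip v' w.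
Proof. exact: linearBl. Qed.

Lemma dotBr v w w' : ip v (w - w') = ip v w - ip v w'.
Proof. exact: linearBr. Qed.

Lemma dot0l w : ip 0 w = 0.
Proof. exact: linear0l. Qed.

Lemma dot_gt0 v : v != 0 -> 0 < ip v v.
Proof. exact: neq0_dnorm_gt0. Qed.

Lemma dot_eq0 v : ip v v = 0 -> v = 0.
Proof. by move=> vv; apply/eqP; apply: contra_eqT vv => /dot_gt0 /gt_eqF ->. Qed.

Lemma dot_ge0 v : 0 <= ip v v.
Proof.
by have [->|/dot_gt0/ltW//] := eqVneq v 0; rewrite dot0l.
Qed.

Section Family.
Context {n : nat}.
Implicit Types (u : 'I_n -> V) (c z : 'I_n -> R).

Definition comb u c := \sum_i c i *: u i.

Definition indep u := forall c, comb u c = 0 -> forall i, c i = 0.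

Lemma combD u c c' : comb u (fun i => c i + c' i) = comb u c + comb u c'.
Proof. by rewrite -big_split; apply: eq_bigr => i _; rewrite scalerDl. Qed.

Lemma combZ u a c : comb u (fun i => a * c i) = a *: comb u c.
Proof. by rewrite scaler_sumr; apply: eq_bigr => i _; rewrite scalerA. Qed.

Lemma combB u c c' : comb u (fun i => c i - c' i) = comb u c - comb u c'.
Proof.
by rewrite -sumrB; apply: eq_bigr => i _; rewrite scalerBl.
Qed.

Lemma comb_sum u (I : finType) (P : pred I) (c : I -> 'I_n -> R) :
  comb u (fun i => \sum_(j | P j) c j i) = \sum_(j | P j) comb u (c j).
Proof.
rewrite /comb exchange_big /=; apply: eq_bigr => i _.
by rewrite scaler_suml.
Qed.

Lemma comb_inj u c c' : indep u -> comb u c = comb u c' -> c =1 c'.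
Proof.
move=> ind /eqP; rewrite -subr_eq0 -combB => /eqP/ind cc i.
by apply/eqP; rewrite -subr_eq0 cc.
Qed.

Lemma dot_comb u c v : ip (comb u c) v = \sum_i c i * ip (u i) v.
Proof. by rewrite linear_sumlz; apply: eq_bigr => i _; exact: dotZl. Qed.

Lemma dot_comb_comb u c c' :
  ip (comb u c) (comb u c') = \sum_i c' i * ip (comb u c) (u i).
Proof. by rewrite linear_sumr; apply: eq_bigr => i _; exact: dotZr. Qed.

Lemma indep_gt0 u i : indep u -> 0 < ip (u i) (u i).
Proof.
move=> ind; apply: dot_gt0; apply/eqP => ui0.
have /(_ i) : forall j, (j == i)%:R = 0 :> R.
  apply: ind; rewrite /comb (bigD1 i)//= ui0 scaler0 add0r big1// => j /negPf->.
  by rewrite scale0r.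
by rewrite eqxx => /eqP; rewrite oner_eq0.
Qed.

(* The coefficients of a vector w_tau in span(u_i | i in tau), with
   w_tau * u_i = z_i for i in tau. *)
Definition vertex u z (tau : {set 'I_n}) c :=
  (forall i, i \notin tau -> c i = 0) /\
  (forall i, i \in tau -> ip (comb u c) (u i) = z i).

(** Every subset of the generators of a simplicial cone spans a face, so the condition on the faces
    of a cone becomes one on all [tau]. For independent [u] the witness [c] is unique by
    [vertex_uniq]. *)
Definition pseudocubical u z := forall tau : {set 'I_n},
  exists2 c, vertex u z tau c & forall i, 0 <= c i.

Definition cubical u z := forall tau : {set 'I_n},
  exists2 c, vertex u z tau c & forall i, i \in tau -> 0 < c i.

(** The difference of two such vectors is a combination of the u_i with i in [tau] and is orthogonal
    to all of these, so its squared norm vanishes. *)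
Lemma vertex_uniq u z tau c c' : indep u ->
  vertex u z tau c -> vertex u z tau c' -> c =1 c'.
Proof.
move=> ind [c1 c2] [d1 d2]; apply: (comb_inj ind); apply/eqP.
rewrite -subr_eq0 -combB; apply/eqP/dot_eq0; rewrite dot_comb_comb big1// => i _.
have [it|it] := boolP (i \in tau); last by rewrite c1// d1// subrr mul0r.
by rewrite combB dotBl c2// d2// subrr mulr0.
Qed.

Lemma vertex_set0 u z c : vertex u z finset.set0 c -> c =1 fun=> 0.
Proof. by move=> [c0 _] i; rewrite c0// inE. Qed.

(* w_(tau + rho) - w_tau is orthogonal to tau, so its squared norm is its
   coefficient at rho times z_rho - w_tau * u_rho. *)
Lemma vertex_le u z tau c : indep u -> pseudocubical u z ->
  vertex u z tau c -> forall i, ip (comb u c) (u i) <= z i.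
Proof.
move=> ind zp [c1 c2] i.
have [it|it] := boolP (i \in tau); first by rewrite c2.
have [d [d1 d2] d0] := zp (i |: tau)%SET.
have di : ip (comb u d) (u i) = z i by rewrite d2// setU11.
pose y := comb u (fun k => d k - c k).
have yE : ip y y = d i * (z i - ip (comb u c) (u i)).
  rewrite {2}/y dot_comb_comb (bigD1 i)//= big1 ?addr0 => [|k ki].
    by rewrite (c1 i)// subr0 combB dotBl di.
  have [kt|kt] := boolP (k \in tau).
    by rewrite combB dotBl c2// d2 ?subrr ?mulr0// inE kt orbT.
  by rewrite c1// d1 ?subrr ?mul0r// !inE negb_or ki.
rewrite leNgt; apply/negP => zlt.
have y0 : y = 0.
  apply: dot_eq0; apply/eqP; rewrite eq_le dot_ge0 andbT yE.
  by rewrite mulr_ge0_le0// subr_le0 ltW.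
have : ip y (u i) = z i - ip (comb u c) (u i) by rewrite /y combB dotBl di.
by rewrite y0 dot0l => /eqP; rewrite eq_sym subr_eq0 => /eqP zE; rewrite zE ltxx in zlt.
Qed.

(** The vector w_{i} is c_i u_i, whence z_i = c_i |u_i|^2. *)
Lemma pseudocubical_ge0 u z i : pseudocubical u z -> 0 <= z i.
Proof.
move=> /(_ [set i]%SET)[c [c1 c2] c0]; rewrite -c2 ?inE// dot_comb (bigD1 i)//=.
rewrite big1 ?addr0; first by rewrite mulr_ge0// dot_ge0.
by move=> k ki; rewrite c1 ?mul0r// inE.
Qed.

Lemma cubical_gt0 u z i : indep u -> cubical u z -> 0 < z i.
Proof.
move=> ind /(_ [set i]%SET)[c [c1 c2] c0]; rewrite -c2 ?inE// dot_comb (bigD1 i)//=.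
rewrite big1 ?addr0; first by rewrite mulr_gt0 ?indep_gt0// c0// inE.
by move=> k ki; rewrite c1 ?mul0r// inE.
Qed.

(** [A] is the inverse of the Gram matrix: a row vector in the kernel of that matrix gives a
    combination orthogonal to every u_j, hence to itself. It recovers coefficients from scalar
    products. *)
Lemma indep_inverse u : indep u -> exists A : 'I_n -> 'I_n -> R,
  forall t j, ip (comb u (fun k => \sum_l t l * A l k)) (u j) = t j.
Proof.
move=> ind; pose G : 'M[R]_n := \matrix_(k, j) ip (u k) (u j).
have GE c j : ip (comb u c) (u j) = ((\row_k c k) *m G) 0 j.
  by rewrite dot_comb mxE; apply: eq_bigr => k _; rewrite !mxE.
have Gu : G \in unitmx.
  rewrite -row_free_unit -kermx_eq0; apply/rowV0P => v /sub_kermxP vG.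
  have vE : v = \row_k v 0 k by apply/rowP => k; rewrite mxE.
  apply/rowP => k; rewrite [RHS]mxE.
  suff /ind -> : comb u (v 0) = 0 by [].
  apply: dot_eq0; rewrite dot_comb_comb big1// => j _.
  by rewrite GE -vE vG mxE mulr0.
exists (invmx G) => t j; rewrite GE.
rewrite [X in X *m _](_ : _ = (\row_l t l) *m invmx G).
  by rewrite -mulmxA mulVmx// mulmx1 mxE.
by apply/rowP => k; rewrite !mxE; apply: eq_bigr => l _; rewrite !mxE.
Qed.

End Family.

Section Projection.
Context {n : nat}.
Implicit Types (u : 'I_n.+1 -> V) (c z : 'I_n.+1 -> R) (i : 'I_n.+1).

Definition slope u i j := ip (u (lift i j)) (u i) / ip (u i) (u i).

Definition proj_fam u i j : V := u (lift i j) - slope u i j *: u i.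

(** If v * u_i = z_i and v * u_k = z_k for k = [lift i j], this is the product of v with
    [proj_fam u i j]. *)
Definition proj_val u i z j : R := z (lift i j) - z i * slope u i j.

Lemma comb_lift u i c :
  comb u c = c i *: u i + comb (u \o lift i) (c \o lift i).
Proof. by rewrite /comb (bigD1_ord i). Qed.

Lemma comb_proj_fam u i (c : 'I_n -> R) : comb (proj_fam u i) c =
  comb (u \o lift i) c - (\sum_j c j * slope u i j) *: u i.
Proof.
rewrite scaler_suml -sumrB; apply: eq_bigr => j _.
by rewrite scalerBr scalerA.
Qed.

Lemma dot_comb_at u i c : indep u -> ip (comb u c) (u i) / ip (u i) (u i) =
  c i + \sum_j c (lift i j) * slope u i j.
Proof.
move=> ind; have ui := indep_gt0 i ind.
rewrite dot_comb (bigD1_ord i)//= mulrDl mulfK ?gt_eqF// mulr_suml.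
by congr (_ + _); apply: eq_bigr => j _; rewrite mulrA.
Qed.

(** Orthogonal splitting along u_i. The projected part keeps the coefficients at the other
    generators, so sign conditions on them carry over. *)
Lemma comb_proj u i c : indep u -> comb u c =
  (ip (comb u c) (u i) / ip (u i) (u i)) *: u i +
  comb (proj_fam u i) (c \o lift i).
Proof.
move=> ind; rewrite dot_comb_at// comb_proj_fam (comb_lift u i) scalerDl /=.
by rewrite -addrA; congr (_ + _); rewrite addrC subrK.
Qed.

Lemma dot_comb_proj0 u i (c : 'I_n -> R) : indep u -> ip (comb (proj_fam u i) c) (u i) = 0.
Proof.
move=> ind; have ui := indep_gt0 i ind; rewrite dot_comb big1// => j _.
by rewrite dotBl dotZl divfK ?gt_eqF// subrr mulr0.
Qed.

Lemma dot_comb_proj u i c j : indep u ->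
  ip (comb (proj_fam u i) (c \o lift i)) (proj_fam u i j) =
  ip (comb u c) (u (lift i j)) - ip (comb u c) (u i) * slope u i j.
Proof.
move=> ind; rewrite [in RHS](comb_proj i c ind) !dotDl !dotZl.
rewrite dot_comb_proj0// addr0 dotBr dotZr dot_comb_proj0// mulr0 subr0.
rewrite divfK ?gt_eqF ?indep_gt0// /slope mulrAC mulrA.
by rewrite (dotC (u i) (u (lift i j))) addrAC subrr add0r.
Qed.

Lemma indep_proj u i : indep u -> indep (proj_fam u i).
Proof.
move=> ind c c0 j.
(* The coefficient at i absorbs the multiples of u_i subtracted by the projection, turning a
   relation of the projected family into one of [u]. *)
pose d := insert_at i (- \sum_j c j * slope u i j) c.
have dE : d \o lift i =1 c by move=> k /=; rewrite /d insert_at_lift.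
have ud : comb u d = comb (proj_fam u i) c.
  rewrite (comb_lift u i) /d insert_at_id comb_proj_fam addrC scaleNr; congr (_ - _).
  by apply: eq_bigr => k _; rewrite dE.
by rewrite -dE /= ind// ud.
Qed.

Lemma vertex_proj u i z (tau : {set 'I_n}) c : indep u ->
  vertex u z (i |: lift i @: tau)%SET c ->
  vertex (proj_fam u i) (proj_val u i z) tau (c \o lift i).
Proof.
move=> ind [c1 c2]; split=> j jt /=.
  apply: c1; rewrite !inE negb_or eq_sym neq_lift /=.
  by rewrite (mem_imset _ _ (@lift_inj _ i)).
by rewrite dot_comb_proj// !c2// !inE ?eqxx// (imset_f _ jt) orbT.
Qed.

Lemma pseudocubical_proj u i z : indep u -> pseudocubical u z ->
  pseudocubical (proj_fam u i) (proj_val u i z).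
Proof.
move=> ind zp tau; have [c cv c0] := zp (i |: lift i @: tau)%SET.
by exists (c \o lift i) => [|j]; [exact: vertex_proj|exact: c0].
Qed.

Lemma cubical_proj u i z : indep u -> cubical u z ->
  cubical (proj_fam u i) (proj_val u i z).
Proof.
move=> ind zp tau; have [c cv c0] := zp (i |: lift i @: tau)%SET.
exists (c \o lift i) => [|j jt]; first exact: vertex_proj.
by apply: c0; rewrite !inE (imset_f _ jt) orbT.
Qed.

End Projection.

Definition truncated n (u : 'I_n -> V) (z c : 'I_n -> R) :=
  forall i, ip (comb u c) (u i) <= z i.

Definition convex_pred n (K : ('I_n -> R) -> Prop) :=
  forall x y s, 0 <= s <= 1 -> K x -> K y ->
    K (fun i => s * x i + (1 - s) * y i).

Definition contains_vertices n (u : 'I_n -> V) z (K : ('I_n -> R) -> Prop) :=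
  forall tau c, vertex u z tau c -> K c.

(** Lying in the convex hull of the w_tau is expressed as lying in every convex [K] that contains
    them. Different choices of [K] then yield signs of coefficients, polytopes and Minkowski
    sums. *)
Definition hull_property n := forall (u : 'I_n -> V) z K c,
  indep u -> pseudocubical u z -> convex_pred K -> contains_vertices u z K ->
  (forall i, 0 <= c i) -> truncated u z c -> K c.

(* Orthogonal projection along u_i identifies the facet v * u_i = z_i with a
   truncated cone of lower dimension, whose vertices are the w_tau with i in
   tau; no sign is needed for the coefficient at i. *)
Lemma facet_hull n (u : 'I_n.+1 -> V) z K c i : hull_property n ->
  indep u -> pseudocubical u z -> convex_pred K -> contains_vertices u z K ->
  (forall j, 0 <= c (lift i j)) -> ip (comb u c) (u i) = z i ->
  truncated u z c -> K c.
Proof.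
move=> hull ind zp Kc Kv c0 ci ct; have ui := indep_gt0 i ind.
(* [ext d] describes the point of the hyperplane v * u_i = z_i that projects to
   [comb (proj_fam ip u i) d]; its coefficient at i is dictated by [dot_comb_at]. As [ext] is
   affine, [K \o ext] is again convex. *)
pose ext (d : 'I_n -> R) : 'I_n.+1 -> R :=
  insert_at i (z i / ip (u i) (u i) - \sum_j d j * slope u i j) d.
have extK d : ip (comb u d) (u i) = z i -> ext (d \o lift i) = d.
  move=> di; apply/funext => k; rewrite /ext; have [j ->|->] := unliftP i k.
    by rewrite insert_at_lift.
  rewrite insert_at_id -di dot_comb_at//=; exact: addrK.
rewrite -(extK c ci); apply: (hull (proj_fam u i) (proj_val u i z) (K \o ext)).
- exact: indep_proj.
- exact: pseudocubical_proj.
- move=> x y s s01 /= Kx Ky.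
  have := Kc _ _ _ s01 Kx Ky; congr K; apply/funext => k; rewrite /ext.
  have [j ->|->] := unliftP i k; first by rewrite !insert_at_lift.
  rewrite !insert_at_id.
  under [in RHS]eq_bigr => j _ do rewrite mulrDl -!mulrA.
  by rewrite big_split /= -!mulr_sumr; ring.
- move=> tau d dv /=; have [e ev _] := zp (i |: lift i @: tau)%SET.
  have -> : d = e \o lift i.
    by apply/funext/(vertex_uniq (indep_proj ind) dv)/vertex_proj.
  by rewrite extK; [exact: Kv ev|rewrite ev.2// setU11].
- by move=> j /=.
- by move=> j; rewrite dot_comb_proj// ci lerB.
Qed.

(** Follow the ray from 0 through the point until it leaves the truncated cone through some facet:
    the point lies between 0, which is the vertex for the empty set, and a point of that facet,
    which [facet_hull] handles by induction. *)
Lemma truncated_hull n : hull_property n.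
Proof.
elim: n => [|n IHn] u z K c ind zp Kc Kv c0 ct.
  apply: (Kv finset.set0); split=> [[]//|i]; by rewrite inE.
have K0 : K (fun=> 0).
  have [d dv _] := zp finset.set0.
  have -> : (fun=> 0) = d by apply/esym/funext/(vertex_set0 dv).
  exact: Kv dv.
pose t i := ip (comb u c) (u i).
have z0 i : 0 <= z i by exact: pseudocubical_ge0 zp.
(* If no t_i is positive, then |v|^2 is the sum of the c_i t_i, hence at most 0, and v = 0. *)
have [[i0 ti0]|tn] := pselect (exists i, 0 < t i); last first.
  suff -> : c = fun=> 0 by [].
  apply/funext/ind/dot_eq0/eqP; rewrite eq_le dot_ge0 andbT dot_comb_comb.
  apply: sumr_le0 => i _; rewrite mulr_ge0_le0// leNgt; apply/negP => ti.
  by apply: tn; exists i.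
(* The facet met first is the one with the largest t_i / z_i; this ratio [s] is at most 1, and
   dividing by it moves the point onto the facet. *)
have [i ti imax] := @arg_maxP _ _ _ i0 (fun i => 0 < t i) (fun i => t i / z i) ti0.
have zi : 0 < z i by apply: lt_le_trans ti (ct i).
pose s := t i / z i.
have s0 : 0 < s by exact: divr_gt0.
have s1 : s <= 1 by rewrite ler_pdivrMr// mul1r; exact: ct.
have -> : c = fun k => s * (s^-1 * c k) + (1 - s) * 0.
  by apply/funext => k; rewrite mulr0 addr0 mulrA mulfV ?gt_eqF// mul1r.
apply: (Kc) => //; first by rewrite ltW.
have sE j : ip (comb u (fun k => s^-1 * c k)) (u j) = s^-1 * t j.
  by rewrite combZ dotZl.
apply: (@facet_hull n u z K _ i) => // [j||j].
- by rewrite mulr_ge0// invr_ge0 ltW.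
- by rewrite sE /s invf_div divfK ?gt_eqF.
- rewrite sE mulrC ler_pdivrMr//; have [tj|tj] := ltP 0 (t j).
    have zj : 0 < z j by apply: lt_le_trans tj (ct j).
    by rewrite mulrC -ler_pdivrMr//; exact: imax.
  by apply: (le_trans tj); rewrite mulr_ge0// ltW.
Qed.

(** The i-th coefficient, on which no sign is assumed, is nonnegative because the point lies in the
    hull of vertices with nonnegative coefficients. This lets facets be recovered from their
    projections. *)
Lemma facet_coef_ge0 n (u : 'I_n.+1 -> V) z c i : indep u -> pseudocubical u z ->
  (forall j, 0 <= c (lift i j)) -> ip (comb u c) (u i) = z i ->
  truncated u z c -> forall j, 0 <= c j.
Proof.
move=> ind zp; apply: (@facet_hull n u z (fun c => forall j, 0 <= c j)) => //.
- exact: truncated_hull.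
- move=> x y s /andP[s0 s1] x0 y0 j.
  by rewrite addr_ge0// mulr_ge0// subr_ge0.
- move=> tau d dv j; have [e ev e0] := zp tau.
  by rewrite (vertex_uniq ind dv ev).
Qed.

End InnerProduct.

(** * Iterated Lebesgue integrals as measures *)

Section TransportMeasure.
Context d1 d2 (T1 : measurableType d1) (T2 : measurableType d2) (R : realType).
Context (f : T1 -> T2) (g : T2 -> T1) (fK : cancel f g) (gK : cancel g f).
Context (mf : measurable_fun [set: T1] f) (mg : measurable_fun [set: T2] g).
Context (m : {measure set T1 -> \bar R}) (sm : sigma_finite setT m).

Let image := pushforward m f.

Let image0 : image set0 = 0%E. Proof. exact: measure0. Qed.

Let image_ge0 A : (0 <= image A)%E. Proof. exact: measure_ge0. Qed.

Let image_sigma_additive : semi_sigma_additive image.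
Proof. exact: measure_semi_sigma_additive. Qed.

HB.instance Definition _ := isMeasure.Build _ _ _ image
  image0 image_ge0 image_sigma_additive.

Let image_sigma_finite : sigma_finite setT image.
Proof.
have [F TF Ffin] := sm.
exists (fun i => g @^-1` F i).
  by rewrite -preimage_bigcup -TF preimage_setT.
move=> i; have [mF Foo] := Ffin i; split.
  by rewrite -[X in measurable X]setTI; exact: mg.
rewrite /image /pushforward -comp_preimage.
by rewrite (_ : g \o f = id)//; apply/funext => x /=; rewrite fK.
Qed.

HB.instance Definition _ := Measure_isSigmaFinite.Build _ _ _ image
  image_sigma_finite.

(** The pushforward along an isomorphism of measurable spaces; pulling a cover back along [g] keeps
    it sigma-finite, as iterating product measures requires. *)
Lemma transport_measure_exists :
  exists m' : {sigma_finite_measure set T2 -> \bar R},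
    forall E, m' E = m (f @^-1` E).
Proof. by exists image. Qed.

End TransportMeasure.

Lemma sigma_finite_prod d1 d2 (T1 : measurableType d1) (T2 : measurableType d2)
    (R : realType) (m1 : {sigma_finite_measure set T1 -> \bar R})
    (m2 : {sigma_finite_measure set T2 -> \bar R}) :
  sigma_finite setT (m1 \x m2)%E.
Proof.
(* Both exhaustions are nondecreasing, so a point of F k x G l lies in the rectangle of index max(k,
   l). *)
have /sigma_finiteP[F [TF ndF Foo]] := sigma_finiteT m1.
have /sigma_finiteP[G [TG ndG Goo]] := sigma_finiteT m2.
exists (fun n => F n `*` G n).
  apply/seteqP; split => // -[x y] _.
  have [k _ Fx] : (\bigcup_i F i) x by rewrite -TF.
  have [l _ Gy] : (\bigcup_i G i) y by rewrite -TG.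
  exists (maxn k l) => //; split => /=.
    by move: x Fx; apply/subsetPset/ndF/leq_maxl.
  by move: y Gy; apply/subsetPset/ndG/leq_maxr.
move=> k; have [mF Fk] := Foo k; have [mG Gk] := Goo k.
split; first exact: measurableX.
by rewrite product_measure1E// lte_mul_pinfty// ge0_fin_numE.
Qed.

Section TupleMeasure.
Context {R : realType}.
Local Notation TR := (measurableTypeR R).
Local Notation mu := (@lebesgue_measure R).

(** The measure is the product of Lebesgue measure with the one in dimension n, transported by
    consing tuples. Agreement is restricted to measurable sets, whereas [lebesgue_n] takes a value
    on every set. *)
Lemma lebesgue_n_measure n :
  exists m : {sigma_finite_measure set (n.-tuple TR) -> \bar R},
    forall E, measurable E -> m E = lebesgue_n E.
Proof.
elim: n => [|n [m mE]]; first by exists (\d_([tuple] : 0.-tuple TR)).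
pose f (p : TR * n.-tuple TR) : n.+1.-tuple TR := [tuple of p.1 :: p.2].
pose g (t : n.+1.-tuple TR) : TR * n.-tuple TR := (thead t, [tuple of behead t]).
have fK : cancel f g by move=> [x t]; congr pair; apply: val_inj.
have gK : cancel g f by move=> t; rewrite /f /g /= [in RHS](tuple_eta t).
have mf : measurable_fun setT f by exact: measurable_cons.
have mg : measurable_fun setT g.
  apply/measurable_fun_pairP; split; first exact: measurable_tnth.
  exact: measurable_behead.
have [m' m'E] := transport_measure_exists fK mf mg (sigma_finite_prod mu m).
exists m' => E mE'; rewrite m'E /=; apply: eq_integral => x _ /=.
have mp : measurable (f @^-1` E) by rewrite -[X in measurable X]setTI; exact: mf.
rewrite mE; last exact: measurable_xsection.
by congr lebesgue_n; apply/seteqP; split => t; rewrite /xsection/= inE.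
Qed.

(** Regions are sets of functions, like the coefficient families; tuples carry the sigma-algebra. *)
Definition coord_set n (E : set ('I_n -> R)) : set (n.-tuple TR) :=
  [set t | E (tnth t)].

Definition coord_measurable n (E : set ('I_n -> R)) := measurable (coord_set E).

Definition vol n (E : set ('I_n -> R)) : \bar R := lebesgue_n (coord_set E).

Lemma coord_measurable_preimage d (T : measurableType d) n (f : T -> 'I_n -> R)
    (E : set ('I_n -> R)) :
  (forall k, measurable_fun [set: T] (fun a => f a k : TR)) ->
  coord_measurable E -> measurable [set a | E (f a)].
Proof.
move=> mf mE; pose g a : n.-tuple TR := [tuple f a k | k < n].
have mg : measurable_fun [set: T] g.
  apply/measurable_fun_tnthP => k.
  by rewrite (_ : _ \o _ = (f ^~ k : T -> TR))//; apply/funext => a /=; rewrite tnth_mktuple.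
rewrite (_ : [set a | _] = g @^-1` coord_set E).
  by rewrite -[X in measurable X]setTI; exact: mg.
apply/seteqP; split => a; rewrite /coord_set /= (_ : tnth (g a) = f a)//;
  by apply/funext => k; rewrite tnth_mktuple.
Qed.

Lemma measurable_slice d (T : measurableType d) n (B : T -> set ('I_n -> R)) x :
  measurable [set p : T * n.-tuple TR | B p.1 (tnth p.2)] ->
  coord_measurable (B x).
Proof.
move=> /(measurable_xsection x); congr measurable.
by apply/seteqP; split => t; rewrite /xsection /= inE.
Qed.

Lemma measurable_vol d (T : measurableType d) n (B : T -> set ('I_n -> R)) :
  measurable [set p : T * n.-tuple TR | B p.1 (tnth p.2)] ->
  measurable_fun [set: T] (fun x => vol (B x)).
Proof.
move=> mB; have [m mE] := lebesgue_n_measure n.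
apply: eq_measurable_fun (measurable_fun_xsection m mB) => x _ /=.
rewrite mE; last exact: measurable_xsection.
by congr lebesgue_n; apply/seteqP; split => t; rewrite /xsection/= inE.
Qed.

Lemma lebesgue_n_ge0 n (E : set (n.-tuple R)) : (0 <= lebesgue_n E)%E.
Proof.
elim: n E => [|n IHn] E /=; first by rewrite lee_fin.
by apply: integral_ge0 => x _; exact: IHn.
Qed.

Lemma vol_ge0 n (E : set ('I_n -> R)) : (0 <= vol E)%E.
Proof. exact: lebesgue_n_ge0. Qed.

Lemma tnth_cons n (x : R) (t : n.-tuple R) :
  tnth [tuple of x :: t] = insert_at ord0 x (tnth t).
Proof.
apply/funext => k; rewrite /insert_at.
by case: unliftP => [j ->|->]; rewrite ?tnthS.
Qed.

Lemma vol_cons n (E : set ('I_n.+1 -> R)) :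
  vol E = (\int[mu]_x vol [set f | E (insert_at ord0 x f)])%E.
Proof.
apply: eq_integral => x _; congr lebesgue_n.
by apply/seteqP; split => t; rewrite /coord_set /= tnth_cons.
Qed.

Lemma measurable_insert n (i : 'I_n.+1) (E : set ('I_n.+1 -> R)) :
  coord_measurable E ->
  measurable [set p : TR * n.-tuple TR | E (insert_at i p.1 (tnth p.2))].
Proof.
move=> mE.
apply: (@coord_measurable_preimage _ _ _ (fun p : TR * n.-tuple TR =>
  insert_at i p.1 (tnth p.2))) => // k.
rewrite /insert_at; case: unliftP => [j _|_]; last exact: measurable_fst.
exact: (measurableT_comp (measurable_tnth j) measurable_snd).
Qed.

Lemma coord_measurable_insert n (i : 'I_n.+1) x (E : set ('I_n.+1 -> R)) :
  coord_measurable E -> coord_measurable [set f | E (insert_at i x f)].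
Proof. by move=> /(measurable_insert i)/(measurable_slice (B := fun x => [set f | E (insert_at i x f)]) x). Qed.

Lemma measurable_vol_insert n (i : 'I_n.+1) (E : set ('I_n.+1 -> R)) :
  coord_measurable E ->
  measurable_fun [set: TR] (fun x => vol [set f | E (insert_at i x f)]).
Proof.
move=> /(measurable_insert i).
exact: (measurable_vol (B := fun x => [set f | E (insert_at i x f)])).
Qed.

Lemma insert_atC n (j : 'I_n.+1) (x y : R) (f : 'I_n -> R) :
  insert_at (lift ord0 j) y (insert_at ord0 x f) =
  insert_at ord0 x (insert_at j y f).
Proof.
apply/funext => k; have [k' ->|->] := unliftP ord0 k.
  rewrite insert_at_lift; have [l ->|->] := unliftP j k'.
    rewrite insert_at_lift.
    have -> : lift ord0 (lift j l) = lift (lift ord0 j) (lift ord0 l).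
      by apply: val_inj; rewrite /= /bump /=; lia.
    by rewrite !insert_at_lift.
  by rewrite !insert_at_id.
rewrite insert_at_id.
have -> : ord0 = lift (lift ord0 j) ord0 :> 'I_n.+2 by apply: val_inj.
by rewrite insert_at_lift -[X in insert_at X _ _ X]/ord0 insert_at_id.
Qed.

(** The iterated integral may start with any coordinate: by induction, coordinate i is brought just
    behind coordinate 0, and Tonelli exchanges the two. *)
Lemma vol_insert n (i : 'I_n.+1) (E : set ('I_n.+1 -> R)) :
  coord_measurable E ->
  vol E = (\int[mu]_x vol [set f | E (insert_at i x f)])%E.
Proof.
elim: n i E => [|n IHn] i E mE.
  by rewrite (ord1 i); exact: vol_cons.
have [j ->|->] := unliftP ord0 i; last exact: vol_cons.
pose h (p : TR * TR) := vol [set g | E (insert_at ord0 p.1 (insert_at j p.2 g))].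
have mh : measurable_fun [set: TR * TR] h.
  apply: (measurable_vol
    (B := fun p => [set g | E (insert_at ord0 p.1 (insert_at j p.2 g))])).
  apply: (@coord_measurable_preimage _ _ _ (fun q : (TR * TR) * n.-tuple TR =>
    insert_at ord0 q.1.1 (insert_at j q.1.2 (tnth q.2)))) => // k.
  rewrite /insert_at; case: unliftP => [l _|_]; last first.
    exact: (measurableT_comp measurable_fst measurable_fst).
  case: unliftP => [k' _|_]; last first.
    exact: (measurableT_comp measurable_snd measurable_fst).
  exact: (measurableT_comp (measurable_tnth k') measurable_snd).
transitivity (\int[mu]_x \int[mu]_y h (x, y))%E.
  rewrite vol_cons; apply: eq_integral => x _.
  by rewrite (IHn j)//; exact: coord_measurable_insert.
rewrite (fubini_tonelli h)//; last by move=> p; exact: vol_ge0.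
apply: eq_integral => y _; rewrite [RHS]vol_cons; apply: eq_integral => x _.
by congr vol; apply/seteqP; split => f /=; rewrite insert_atC.
Qed.

Lemma vol_set0 n : vol (@set0 ('I_n -> R)) = 0%E.
Proof.
have [m mE] := lebesgue_n_measure n.
by rewrite /vol -mE; [exact: measure0|exact: measurable0].
Qed.

Lemma le_vol n (A B : set ('I_n -> R)) : coord_measurable A ->
  coord_measurable B -> A `<=` B -> (vol A <= vol B)%E.
Proof.
move=> mA mB AB; have [m mE] := lebesgue_n_measure n.
by rewrite /vol -!mE//; apply: le_measure; rewrite ?inE// => t; exact: AB.
Qed.

Definition coord_null n (A : set ('I_n -> R)) := coord_measurable A /\ vol A = 0%E.

Lemma coord_nullU n (A B : set ('I_n -> R)) :
  coord_null A -> coord_null B -> coord_null (A `|` B).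
Proof.
move=> [mA A0] [mB B0]; have [m mE] := lebesgue_n_measure n.
have mAB : coord_measurable (A `|` B) by exact: measurableU.
split=> //; apply/eqP; rewrite eq_le vol_ge0 andbT.
rewrite -[leRHS]add0e -{1}A0 -B0 /vol -!mE//; exact: measureU2.
Qed.

Lemma coord_null_exists n p (A : 'I_p -> set ('I_n -> R)) :
  (forall k, coord_null (A k)) -> coord_null [set f | exists k, A k f].
Proof.
elim: p A => [|p IHp] A A0.
  rewrite (_ : [set f | _] = set0).
    by split; [exact: measurable0|exact: vol_set0].
  by apply/seteqP; split => // f [[]].
rewrite (_ : [set f | _] = A ord0 `|` [set f | exists k, A (lift ord0 k) f]).
  by apply: coord_nullU => //; exact: IHp.
apply/seteqP; split => f.
  by move=> [k]; have [j ->|->] := unliftP ord0 k; [right; exists j|left].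
by move=> [Af|[k Af]]; [exists ord0|exists (lift ord0 k)].
Qed.

Lemma vol_partition n p (A : 'I_p -> set ('I_n -> R)) B N :
  (forall k, coord_measurable (A k)) -> coord_measurable B -> coord_null N ->
  (forall i j f, A i f -> A j f -> i = j) ->
  (forall i, A i `<=` B) -> B `<=` [set f | exists k, A k f] `|` N ->
  vol B = (\sum_k vol (A k))%E.
Proof.
move=> mA mB [mN N0] disj AB BAN; have [m mE] := lebesgue_n_measure n.
pose F k := coord_set (A k).
have mF : measurable (\big[setU/set0]_k F k).
  by apply: bigsetU_measurable => k _; exact: mA.
rewrite /vol -mE//; under eq_bigr => k _ do rewrite -(mE _ (mA _)).
rewrite -(@measure_bigsetU_ord _ _ _ m p predT F)//; last first.
  apply/trivIsetP => i j _ _; apply: contra_neqP => /eqP/set0P[t [Fi Fj]].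
  exact: disj Fi Fj.
apply/eqP; rewrite eq_le; apply/andP; split; last first.
  apply: le_measure; rewrite ?inE// => t.
  by rewrite -bigcup_seq => -[k _]; exact: AB.
rewrite -[leRHS]adde0 -N0 /vol -(mE _ mN).
apply: le_trans (measureU2 _ mF mN); apply: le_measure; rewrite ?inE//.
  exact: measurableU.
move=> t /BAN[[k Ak]|]; [left|by right].
by rewrite -bigcup_seq; exists k => //=; rewrite mem_index_enum.
Qed.

Lemma coord_measurable_eq n (i : 'I_n) (a : R) :
  coord_measurable [set f | f i = a].
Proof.
rewrite /coord_measurable (_ : coord_set _ = (@tnth n TR ^~ i) @^-1` [set a])//.
rewrite -[X in measurable X]setTI; apply: (measurable_tnth i) => //.
Qed.

Lemma vol_hyperplane n (i : 'I_n.+1) (a : R) : vol [set f | f i = a] = 0%E.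
Proof.
rewrite (vol_insert i); last exact: coord_measurable_eq.
(* Only the slice at x = a is nonempty. Its volume may be infinite, but a single point contributes
   nothing to the integral. *)
transitivity (\int[mu]_(x in [set a])
    vol [set f : 'I_n -> R | insert_at i x f i = a])%E; last exact: integral_set1.
rewrite [RHS]integral_mkcond/=; apply: eq_integral => x _.
rewrite patchE; case: ifPn => //; rewrite notin_setE /= => xa.
rewrite (_ : [set f | _] = set0) ?vol_set0//.
by apply/seteqP; split => f //=; rewrite insert_at_id.
Qed.

Lemma coord_null_hyperplane n (i : 'I_n) (a : R) : coord_null [set f | f i = a].
Proof.
split; first exact: coord_measurable_eq.
by case: n i => [[]//|n] i; exact: vol_hyperplane.
Qed.

(** Fixing the i-th coordinate to x leaves the hyperplane f_j = x a / b, so every slice is null. *)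
Lemma coord_null_ratio n (i j : 'I_n) (a b : R) : i != j -> b != 0 ->
  coord_null [set f | f i * a = f j * b].
Proof.
move=> ij b0.
have mE : coord_measurable [set f : 'I_n -> R | f i * a = f j * b].
  have mf : measurable_fun [set: n.-tuple TR]
      (fun t => tnth t i * a - tnth t j * b).
    by apply: measurable_funB; apply: measurable_funM => //; exact: measurable_tnth.
  rewrite /coord_measurable (_ : coord_set _ =
      (fun t : n.-tuple TR => tnth t i * a - tnth t j * b) @^-1` [set 0]).
    by rewrite -[X in measurable X]setTI; apply: mf => //; exact: measurable_set1.
  apply/seteqP; split => t; rewrite /coord_set /=.
    by move=> ->; rewrite subrr.
  by move=> /eqP; rewrite subr_eq0 => /eqP.
split=> //; case: n i j ij mE => [[]//|n] i j ij mE.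
rewrite (vol_insert i)//; apply: integral0_eq => x _.
have [k jE] : exists k, j = lift i k.
  by have [k ->|ji] := unliftP i j; [exists k|rewrite ji eqxx in ij].
case: n i j ij mE k jE => [|n] i j ij mE; first by case.
move=> k jE; rewrite -(vol_hyperplane k (x * a / b)); congr vol.
apply/seteqP; split => f /=; rewrite jE insert_at_id insert_at_lift.
  by move=> ->; rewrite mulfK.
by move=> ->; rewrite divfK.
Qed.

End TupleMeasure.

Section VolumeComputations.
Context {R : realType}.
Local Notation TR := (measurableTypeR R).
Local Notation mu := (@lebesgue_measure R).

(** The slice at height x of a pyramid of height z is its base scaled by x / z; this integrates the
    resulting factor (x / z)^n. *)
Lemma integral_power (z : R) n : 0 < z ->
  (\int[mu]_(x in `]0%R, z[) ((x / z) ^+ n)%:E)%E = (z / n.+1%:R)%:E.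
Proof.
move=> z0; pose F x := (z ^+ n)^-1 / n.+1%:R * x ^+ n.+1.
have cX m x : {for x, continuous (fun y : R => y ^+ m)} by exact: exprn_continuous.
have cF x : {for x, continuous F}.
  by apply: cvgM; [exact: cvg_cst|exact: cX].
have cf x : {for x, continuous (fun y : R => (y / z) ^+ n)}.
  apply: (@continuous_comp _ _ _ (fun y : R => y / z) (fun y : R => y ^+ n)).
    by apply: cvgM; [exact: cvg_id|exact: cvg_cst].
  exact: cX.
have dF (x : R) : derivable F x 1.
  by apply: derivableM; [exact: derivable_cst|exact: exprn_derivable].
have F'E (x : R) : F^`()%classic x = (x / z) ^+ n.
  rewrite derive1Ml; last exact: exprn_derivable.
  rewrite exp_derive1 /= /GRing.scale /= expr_div_n.
  by field; rewrite expf_eq0 (gt_eqF z0) andbF nat1r pnatr_eq0.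
transitivity (\int[mu]_(x in `[0%R, z]) ((x / z) ^+ n)%:E)%E.
  rewrite (@integral_itv_bndoo _ 0 z (fun x => ((x / z) ^+ n)%:E) true false)//.
  apply/measurable_EFinP; apply: measurable_funX.
  exact: measurable_funM.
rewrite (@continuous_FTC2 _ _ F)//.
- rewrite /F expr0n /= mulr0 oppr0 adde0; congr EFin.
  rewrite exprS; field.
  by rewrite expf_eq0 (gt_eqF z0) andbF nat1r pnatr_eq0.
- by apply: continuous_in_subspaceT => x _; exact: cf.
- split => [x _|//|//]; first exact: dF.
  + by apply: cvg_at_right_filter; exact: cF.
  + by apply: cvg_at_left_filter; exact: cF.
Qed.

(** The right side is a measure that agrees with Lebesgue measure on half-open intervals, and these
    determine it. *)
Lemma lebesgue_affine (l a : R) (A : set TR) : 0 < l -> measurable A ->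
  mu A = (l%:E * mu [set x : TR | A (l * x + a)%R])%E.
Proof.
move=> l0 mA.
pose phi (x : TR) : TR := l * x + a.
have mphi : measurable_fun [set: TR] phi.
  by apply: measurable_funD => //; apply: measurable_funM.
pose k : {nonneg R} := NngNum (ltW l0).
rewrite (@lebesgue_measure_unique R (mscale k (pushforward mu phi)))//.
move=> _ [[x y] _ <-] /=; rewrite /mscale /= /pushforward.
rewrite (_ : phi @^-1` _ = `](x - a) / l, (y - a) / l]%classic).
  rewrite !lebesgue_measure_itv /= !lte_fin ltr_pM2r ?invr_gt0// ltrD2r.
  case: ifP => _; last by rewrite mule0.
  by rewrite -!EFinB -EFinM; congr EFin; field; rewrite gt_eqF.
apply/seteqP; split => t; rewrite /phi /= !in_itv /= ltr_pdivrMr// ler_pdivlMr//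
  ltrBlDr lerBrDr (mulrC t) //.
Qed.

Lemma integral_affine (l a : R) (g : TR -> \bar R) : 0 < l ->
  measurable_fun [set: TR] g -> (forall x, 0 <= g x)%E ->
  (\int[mu]_x g (l * x + a)%R = l^-1%:E * \int[mu]_x g x)%E.
Proof.
move=> l0 mg g0.
pose phi (x : TR) : TR := l * x + a.
have mphi : measurable_fun [set: TR] phi.
  by apply: measurable_funD => //; apply: measurable_funM.
pose k : {nonneg R} := NngNum (ltW l0).
rewrite (@eq_measure_integral _ _ _ setT (mscale k (pushforward mu phi)) mu g)//; last first.
  by move=> A mA _; exact: (lebesgue_affine a l0 mA).
rewrite ge0_integral_mscale//.
rewrite muleA -EFinM mulVf ?gt_eqF// mul1e.
by rewrite ge0_integral_pushforward.
Qed.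

Lemma insert_atZD n (i : 'I_n.+1) (l x : R) (a : 'I_n.+1 -> R) f :
  (fun k => l * insert_at i x f k + a k) =
  insert_at i (l * x + a i) (fun k => l * f k + a (lift i k)).
Proof.
apply/funext => k; have [j ->|->] := unliftP i k; first by rewrite !insert_at_lift.
by rewrite !insert_at_id.
Qed.

Lemma vol_affine n (l : R) (a : 'I_n -> R) (E : set ('I_n -> R)) : 0 < l ->
  coord_measurable E ->
  vol [set f | E (fun k => l * f k + a k)] = (((l ^+ n)^-1)%:E * vol E)%E.
Proof.
move=> l0; elim: n a E => [|n IHn] a E mE.
  rewrite expr0 invr1 mul1e; congr vol; apply/seteqP; split => f /=;
    by congr E; apply/funext => -[].
rewrite vol_cons.
transitivity (\int[mu]_x (((l ^+ n)^-1)%:E *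
    vol [set f | E (insert_at ord0 (l * x + a ord0)%R f)]))%E.
  apply: eq_integral => x _.
  rewrite -(IHn (fun k => a (lift ord0 k))); last exact: coord_measurable_insert.
  by congr vol; apply/seteqP; split => f /=; rewrite insert_atZD.
have l1 : 0 <= (l ^+ n)^-1 by rewrite invr_ge0 exprn_ge0// ltW.
have mg := measurable_vol_insert ord0 mE.
rewrite ge0_integralZl_EFin//; last 2 first.
- by move=> x _; exact: vol_ge0.
- apply: (measurableT_comp mg).
  by apply: measurable_funD => //; apply: measurable_funM.
rewrite (integral_affine (a ord0) l0 mg); last by move=> x; exact: vol_ge0.
by rewrite -vol_cons muleA -EFinM exprS invfM mulrC.
Qed.

Lemma coord_measurable_le n (F G : ('I_n -> R) -> R) :
  measurable_fun [set: n.-tuple TR] (fun t => F (tnth t)) ->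
  measurable_fun [set: n.-tuple TR] (fun t => G (tnth t)) ->
  coord_measurable [set f | F f <= G f].
Proof.
by move=> mF mG; have := measurable_fun_le measurableT mF mG; rewrite setTI.
Qed.

Lemma coord_measurable_lt n (F G : ('I_n -> R) -> R) :
  measurable_fun [set: n.-tuple TR] (fun t => F (tnth t)) ->
  measurable_fun [set: n.-tuple TR] (fun t => G (tnth t)) ->
  coord_measurable [set f | F f < G f].
Proof.
move=> mF mG; rewrite (_ : [set f | _] = ~` [set f | G f <= F f]).
  by apply: measurableC; exact: coord_measurable_le.
by apply/seteqP; split => f /=; rewrite ltNge => /negP.
Qed.

Lemma coord_measurable_forall n p (A : 'I_p -> set ('I_n -> R)) :
  (forall k, coord_measurable (A k)) ->
  coord_measurable [set f | forall k, A k f].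
Proof.
move=> mA; rewrite /coord_measurable.
rewrite (_ : coord_set _ = \bigcap_(k in [set: 'I_p]) coord_set (A k)).
  by apply: fin_bigcap_measurable => // k _; exact: mA.
by apply/seteqP; split => t /= At k; [move=> _|]; exact: At.
Qed.

Lemma coord_measurableI n (A B : set ('I_n -> R)) :
  coord_measurable A -> coord_measurable B -> coord_measurable (A `&` B).
Proof. exact: measurableI. Qed.

Lemma vol_box n (b : R) : 0 <= b ->
  vol [set f : 'I_n -> R | forall i, 0 <= f i <= b] = (b ^+ n)%:E.
Proof.
move=> b0; elim: n => [|n IHn].
  rewrite /vol /= expr0 /indic mem_set//=; by case.
rewrite vol_cons.
transitivity (\int[mu]_(x in `[0%R, b]) (cst (b ^+ n)%:E) x)%E; last first.
  rewrite integral_cst//= lebesgue_measure_itv /= lte_fin oppr0 adde0.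
  case: ifPn => [_|]; first by rewrite -EFinM exprSr.
  by rewrite -leNgt => b1; rewrite mule0 exprSr (_ : b = 0) ?mulr0//; apply/le_anti/andP.
rewrite [RHS]integral_mkcond; apply: eq_integral => x _.
rewrite patchE; case: ifPn => [|].
  rewrite inE /= in_itv /= => xb; rewrite -IHn; congr vol.
  apply/seteqP; split => f /= fb i; first by have := fb (lift ord0 i); rewrite insert_at_lift.
  have [j ->|->] := unliftP ord0 i; first by rewrite insert_at_lift.
  by rewrite insert_at_id.
rewrite notin_setE /= in_itv /= => xb.
rewrite (_ : [set f | _] = set0) ?vol_set0//.
by apply/seteqP; split => f //= /(_ ord0); rewrite insert_at_id.
Qed.

End VolumeComputations.

(** * Volumes of truncated cones *)

Section TruncatedConeRegions.
Context {R : realType} {V : lmodType R} (ip : {dot V for idfun}).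
Local Notation TR := (measurableTypeR R).
Local Notation mu := (@lebesgue_measure R).

(** A flag chooses a generator, then one of the remaining ones, and so on; there are n! of them. *)
Fixpoint flag (n : nat) : finType :=
  if n is m.+1 then ('I_m.+1 * flag m)%type : finType else unit.

(* Up to the norms of the successive projections, the distance from
   w_(tau_k) to w_(tau_k+1) along the flag t. *)
Fixpoint flag_form (n : nat) :
    ('I_n -> V) -> flag n -> 'I_n -> ('I_n -> R) -> R :=
  match n with
  | 0 => fun _ _ _ _ => 1
  | m.+1 => fun u t k z =>
      if unlift ord0 k is Some j
      then flag_form (proj_fam ip u t.1) t.2 j (proj_val ip u t.1 z)
      else z t.1
  end.

Definition flag_volume n (u : 'I_n -> V) z :=
  \sum_(t : flag n) \prod_k flag_form u t k z.

Lemma flag_volumeS n (u : 'I_n.+1 -> V) z : flag_volume u z =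
  \sum_i z i * flag_volume (proj_fam ip u i) (proj_val ip u i z).
Proof.
rewrite /flag_volume.
under [RHS]eq_bigr => i _ do rewrite mulr_sumr.
rewrite pair_bigA /=; apply: eq_bigr => t _.
rewrite big_ord_recl /= unlift_none; congr (_ * _).
by apply: eq_bigr => k _; rewrite liftK.
Qed.

Lemma proj_val_sum n (u : 'I_n.+1 -> V) i (J : finType) (P : pred J)
    (z : J -> 'I_n.+1 -> R) :
  proj_val ip u i (fun k => \sum_(j | P j) z j k) =
  fun k => \sum_(j | P j) proj_val ip u i (z j) k.
Proof.
by apply/funext => k; rewrite /proj_val mulr_suml -sumrB.
Qed.

(** Additivity of the forms is what allows the volume of a Minkowski sum to be expanded when
    polarizing. *)
Lemma flag_form_sum n (u : 'I_n -> V) t k (J : finType) (P : pred J)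
    (z : J -> 'I_n -> R) :
  flag_form u t k (fun i => \sum_(j | P j) z j i) =
  \sum_(j | P j) flag_form u t k (z j).
Proof.
elim: n u t k z => [|n IHn] u t k z; first by case: k.
by rewrite /=; case: unliftP => [j _|//]; rewrite proj_val_sum IHn.
Qed.

Lemma flag_form_ge0 n (u : 'I_n -> V) t k z : indep u -> pseudocubical ip u z ->
  0 <= flag_form u t k z.
Proof.
elim: n u t k z => [|n IHn] u t k z ind zp //=.
case: unliftP => [j _|_]; last exact: pseudocubical_ge0 zp.
by apply: IHn; [exact: indep_proj|exact: pseudocubical_proj].
Qed.

Lemma flag_form_gt0 n (u : 'I_n -> V) t k z : indep u -> cubical ip u z ->
  0 < flag_form u t k z.
Proof.
elim: n u t k z => [|n IHn] u t k z ind zp //=.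
case: unliftP => [j _|_]; last exact: cubical_gt0 zp.
by apply: IHn; [exact: indep_proj|exact: cubical_proj].
Qed.

Lemma flag_inhabited n : flag n.
Proof. by elim: n => [|n t]; [exact: tt|exact: (ord0, t)]. Qed.

Definition cone_region n (u : 'I_n -> V) : set ('I_n -> R) :=
  [set t | exists2 c, forall k, 0 <= c k & forall j, t j = ip (comb u c) (u j)].

(** The strict bounds match those of the pyramids; [vol_closed_region] restores the closed ones, at
    the cost of a null set. *)
Definition region n (u : 'I_n -> V) (z : 'I_n -> R) : set ('I_n -> R) :=
  cone_region u `&` [set t | forall j, t j < z j].

Lemma measurable_tnth_R n (i : 'I_n) :
  measurable_fun [set: n.-tuple TR] (fun t => tnth t i : R).
Proof. exact: measurable_tnth. Qed.

(** The inverse Gram matrix describes the cone by finitely many linear inequalities in t. *)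
Lemma coord_measurable_cone n (u : 'I_n -> V) : indep u ->
  coord_measurable (cone_region u).
Proof.
move=> ind; have [A AE] := indep_inverse ip ind.
rewrite (_ : cone_region u = [set t | forall k, 0 <= \sum_l t l * A l k]).
  apply: coord_measurable_forall => k.
  apply: (@coord_measurable_le _ _ (fun=> 0)) => //.
  apply: measurable_sum => l; apply: measurable_funM => //.
  exact: measurable_tnth_R.
apply/seteqP; split => [t [c c0 tE] k|t t0]; last first.
  by exists (fun k => \sum_l t l * A l k) => // j; rewrite AE.
suff cE : c = fun k => \sum_l t l * A l k by have := c0 k; rewrite {1}cE.
apply/funext; apply: (vertex_uniq (z := t) (tau := finset.setT) ind).
  by split => [i|i _]; rewrite ?inE// tE.
by split => [i|i _]; rewrite ?inE// AE.
Qed.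

Lemma coord_measurable_region n (u : 'I_n -> V) z : indep u ->
  coord_measurable (region u z).
Proof.
move=> ind; apply: coord_measurableI; first exact: coord_measurable_cone.
apply: coord_measurable_forall => k.
apply: (@coord_measurable_lt _ _ _ (fun=> z k)) => //.
exact: measurable_tnth_R.
Qed.

Lemma cone_regionZ n (u : 'I_n -> V) s t : 0 <= s -> cone_region u t ->
  cone_region u (fun k => s * t k).
Proof.
move=> s0 [c c0 tE]; exists (fun k => s * c k) => [k|j].
  exact: mulr_ge0.
by rewrite combZ dotZl tE.
Qed.

(** Projecting along u_i shifts each remaining coordinate by z_i times the slope. For the converse
    the point is lifted back to the hyperplane v * u_i = z_i. *)
Lemma facet_region n (u : 'I_n.+1 -> V) z i y : indep u -> pseudocubical ip u z ->
  (cone_region u (insert_at i (z i) y) /\ forall j, y j < z (lift i j)) <->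
  region (proj_fam ip u i) (proj_val ip u i z)
    (fun j => y j - z i * slope ip u i j).
Proof.
move=> ind zp; split=> [[[c c0 yE] yz]|[[c c0 yE] yz]]; split => [|j /=].
- exists (c \o lift i) => [k|j /=]; first exact: c0.
  rewrite dot_comb_proj// -!yE insert_at_id insert_at_lift//.
- by rewrite ltrD2r.
- pose d := insert_at i (z i / ip (u i) (u i) - \sum_j c j * slope ip u i j) c.
  have dl j : d (lift i j) = c j by rewrite /d insert_at_lift.
  have dc : d \o lift i = c by apply/funext => k; exact: dl.
  have dii : d i = z i / ip (u i) (u i) - \sum_j c j * slope ip u i j.
    by rewrite /d insert_at_id.
  have ui := indep_gt0 ip i ind.
  have di : ip (comb u d) (u i) = z i.
    have := dot_comb_at ip i d ind.
    under eq_bigr => j _ do rewrite dl.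
    rewrite dii.
    rewrite subrK => /(congr1 (fun r => r * ip (u i) (u i))).
    by rewrite !divfK ?gt_eqF.
  have dj j : ip (comb u d) (u (lift i j)) = y j.
    have := @dot_comb_proj _ _ ip _ u i d j ind; rewrite di dc -yE.
    by move=> /addIr.
  exists d => [|j]; last first.
    have [k ->|->] := unliftP i j; first by rewrite insert_at_lift dj.
    by rewrite insert_at_id di.
  (* The lift could have a negative coefficient at i; pseudocubicality excludes this. *)
  apply: (facet_coef_ge0 ind zp (i := i)) => // [j|j].
    by rewrite dl.
  have [k ->|->] := unliftP i j; last by rewrite di.
  by rewrite dj; have := yz k; rewrite ltrD2r => /ltW.
- by have := yz j; rewrite /= ltrD2r.
Qed.

End TruncatedConeRegions.

Section PyramidDecomposition.
Context {R : realType} {V : lmodType R} (ip : {dot V for idfun}).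
Local Notation TR := (measurableTypeR R).
Local Notation mu := (@lebesgue_measure R).

(* The pyramid with apex 0 over the facet t_i = z_i. *)
Definition pyramid n (u : 'I_n.+1 -> V) z i : set ('I_n.+1 -> R) :=
  [set t | [/\ cone_region ip u t, 0 < t i < z i &
    forall j, t (lift i j) * z i < z (lift i j) * t i]].

Lemma coord_measurable_pyramid n (u : 'I_n.+1 -> V) z i : indep u ->
  coord_measurable (pyramid u z i).
Proof.
move=> ind; rewrite (_ : pyramid u z i = cone_region ip u `&`
  (([set t | 0 < t i] `&` [set t | t i < z i]) `&`
   [set t | forall j, t (lift i j) * z i < z (lift i j) * t i])).
  apply: coord_measurableI; first exact: coord_measurable_cone.
  apply: coord_measurableI; last first.
    apply: coord_measurable_forall => k; apply: coord_measurable_lt;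
      by apply: measurable_funM => //; exact: measurable_tnth_R.
  apply: coord_measurableI.
    by apply: (@coord_measurable_lt _ _ (fun=> 0)) => //; exact: measurable_tnth_R.
  by apply: (@coord_measurable_lt _ _ _ (fun=> z i)) => //; exact: measurable_tnth_R.
apply/seteqP; split => [t [tc /andP[? ?] ?]|t [tc [[t0 tz] ?]]]; split => //.
by rewrite t0.
Qed.

(** Scaling by z_i / x carries the slice at height x onto the facet t_i = z_i, where [facet_region]
    applies. *)
Lemma pyramid_slice n (u : 'I_n.+1 -> V) z i x : indep u ->
  pseudocubical ip u z -> 0 < x < z i ->
  [set f | pyramid u z i (insert_at i x f)] =
  [set f | region ip (proj_fam ip u i) (proj_val ip u i z)
    (fun k => (x / z i)^-1 * f k + - (z i * slope ip u i k))].
Proof.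
move=> ind zp /andP[x0 xz]; have z0 : 0 < z i by exact: lt_trans xz.
have s0 : 0 < x / z i by exact: divr_gt0.
apply/seteqP; split => f /=.
  move=> [fc _ fz]; apply/(facet_region _ _ ind zp); split.
    have := cone_regionZ (ltW (_ : 0 < (x / z i)^-1)) fc.
    rewrite invr_gt0 => /(_ s0); congr cone_region; apply/funext => k.
    have [j ->|->] := unliftP i k; first by rewrite !insert_at_lift.
    by rewrite !insert_at_id invf_div divfK// gt_eqF.
  move=> j; have := fz j; rewrite insert_at_id insert_at_lift.
  by rewrite invf_div mulrAC ltr_pdivrMr// (mulrC (z i)).
move=> /(facet_region _ _ ind zp)[fc fz]; split.
- have := cone_regionZ (ltW s0) fc; congr cone_region; apply/funext => k.
  have [j ->|->] := unliftP i k.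
    by rewrite !insert_at_lift mulrA mulfV ?mul1r// gt_eqF.
  by rewrite !insert_at_id divfK// gt_eqF.
- by rewrite insert_at_id x0.
- move=> j; have := fz j; rewrite insert_at_id insert_at_lift.
  by rewrite invf_div mulrAC ltr_pdivrMr// (mulrC (z i)).
Qed.

Lemma vol_pyramid n (u : 'I_n.+1 -> V) z i : indep u ->
  pseudocubical ip u z ->
  vol (pyramid u z i) = ((z i / n.+1%:R)%:E *
    vol (region ip (proj_fam ip u i) (proj_val ip u i z)))%E.
Proof.
move=> ind zp; set W := vol (region _ _ _).
have W0 : (0 <= W)%E by exact: vol_ge0.
have mP := coord_measurable_pyramid z i ind.
(* Pseudocubical values may vanish; then the pyramid is empty and the formula reads 0. *)
have [z0|z0] := eqVneq (z i) 0.
  rewrite z0 mul0r mul0e (_ : pyramid u z i = set0) ?vol_set0//.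
  apply/seteqP; split => // t [_ /andP[t0 tz] _].
  by rewrite z0 ltNge ltW in tz.
have {}z0 : 0 < z i by rewrite lt_neqAle eq_sym z0 (pseudocubical_ge0 i zp).
rewrite (vol_insert i)// -(integral_power n z0).
rewrite -ge0_integralZr//; last 2 first.
- apply/measurable_EFinP; apply: measurable_funX; exact: measurable_funM.
- move=> x; rewrite /= in_itv /= => /andP[x0 _].
  by rewrite lee_fin exprn_ge0// divr_ge0// ltW.
rewrite [RHS]integral_mkcond; apply: eq_integral => x _.
rewrite patchE; case: ifPn => [|].
  rewrite inE /= in_itv /= => xz; rewrite pyramid_slice//.
  rewrite (@vol_affine R n (x / z i)^-1 (fun k => - (z i * slope ip u i k)) (region _ _ _)).
  - by rewrite -exprVn invrK.
  - by rewrite invr_gt0 divr_gt0//; case/andP: xz.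
  - by apply: coord_measurable_region; exact: indep_proj.
rewrite notin_setE /= in_itv /= => xz.
rewrite (_ : [set f | _] = set0) ?vol_set0//.
by apply/seteqP; split => f // [_]; rewrite insert_at_id => /xz.
Qed.

(** The inequalities say that t_i / z_i strictly exceeds all other t_j / z_j, cross-multiplied since
    z_j may be 0; two indices cannot both be the strict maximum. *)
Lemma pyramid_disjoint n (u : 'I_n.+1 -> V) z i j t :
  pyramid u z i t -> pyramid u z j t -> i = j.
Proof.
move=> [_ /andP[ti tz] tiz] [_ /andP[tj tjz] tjz'].
have [k jE|//] := unliftP i j.
have [l iE|ij] := unliftP j i; last by rewrite {1}ij.
have := tiz k; have := tjz' l; rewrite -iE -jE (mulrC (z i)) => h1 h2.
by have := lt_trans h1 h2; rewrite mulrC ltxx.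
Qed.

Lemma pyramid_sub n (u : 'I_n.+1 -> V) z i : pseudocubical ip u z ->
  pyramid u z i `<=` region ip u z.
Proof.
move=> zp t [tc /andP[t0 tz] tiz]; split=> // j.
have [k ->|->//] := unliftP i j.
have z0 : 0 < z i by exact: lt_trans tz.
rewrite -(ltr_pM2r z0); apply: lt_le_trans (tiz k) _.
by rewrite ler_wpM2l ?(pseudocubical_ge0 _ zp)// ltW.
Qed.

(** The coordinate hyperplanes, and the ties between t_i / z_i and t_j / z_j. The condition on z_i
    keeps the latter proper hyperplanes: for z_i = z_j = 0 the equation would hold everywhere. *)
Definition pyramid_walls n (z : 'I_n -> R) : set ('I_n -> R) :=
  [set t | exists i, t i = 0] `|`
  [set t | exists i j, [/\ i != j, z i != 0 & t j * z i = t i * z j]].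

Lemma coord_null_pyramid_walls n (z : 'I_n -> R) : coord_null (pyramid_walls z).
Proof.
apply: coord_nullU.
  by apply: coord_null_exists => i; exact: coord_null_hyperplane.
suff wall i j : coord_null
    [set t : 'I_n -> R | [/\ i != j, z i != 0 & t j * z i = t i * z j]].
  apply: coord_null_exists => i; exact: (coord_null_exists (wall i)).
have [/andP[ij zi]|h] := boolP ((i != j) && (z i != 0)).
  have := coord_null_ratio (z j) ij zi; congr coord_null.
  by apply/seteqP; split => t /=; [move=> ->|case=> _ _ ->].
rewrite (_ : [set t | _] = set0).
  by split; [exact: measurable0|exact: vol_set0].
by apply/seteqP; split => // t [ij zi _]; rewrite ij zi in h.
Qed.

(** A point belongs to the pyramid of the index maximizing t_i / z_i among the positive t_i. Off the
    walls the maximum is strict, and a t_j that is not positive is negative. *)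
Lemma region_sub_pyramids n (u : 'I_n.+1 -> V) z : indep u ->
  pseudocubical ip u z ->
  region ip u z `<=` [set t | exists i, pyramid u z i t] `|` pyramid_walls z.
Proof.
move=> ind zp t [[c c0 tE] tz].
have [?|tw] := pselect (pyramid_walls z t); [by right|left].
have t0 i : t i != 0.
  by apply/eqP => ti; apply: tw; left; exists i.
have [i0 ti0] : exists i, 0 < t i.
  apply: contrapT => tn.
  have /eqP := t0 ord0; apply; rewrite tE.
  suff -> : comb u c = 0 by rewrite dot0l.
  apply: (dot_eq0 (ip := ip)); apply/eqP; rewrite eq_le dot_ge0 andbT dot_comb_comb.
  apply: sumr_le0 => i _; rewrite mulr_ge0_le0// leNgt -tE; apply/negP => ti.
  by apply: tn; exists i.
have [i ti imax] := @arg_maxP _ _ _ i0 (fun i => 0 < t i) (fun i => t i / z i) ti0.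
have zi : 0 < z i by exact: lt_trans ti (tz i).
exists i; split; [by exists c|by rewrite ti tz|move=> j].
have [tj|tj] := ltP 0 (t (lift i j)); last first.
  apply: (@lt_le_trans _ _ 0).
    by rewrite nmulr_rlt0// lt_neqAle t0.
  by rewrite mulr_ge0 ?(pseudocubical_ge0 _ zp)// ltW.
have zj : 0 < z (lift i j) by exact: lt_trans tj (tz _).
rewrite lt_neqAle; apply/andP; split.
  apply/eqP => h; apply: tw; right; exists i, (lift i j).
  by split; rewrite ?neq_lift ?gt_eqF// h mulrC.
have : t (lift i j) / z (lift i j) <= t i / z i by exact: imax.
rewrite ler_pdivrMr// mulrAC ler_pdivlMr//.
by rewrite [leRHS]mulrC.
Qed.

Lemma vol_region n (u : 'I_n -> V) z : indep u -> pseudocubical ip u z ->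
  vol (region ip u z) = (flag_volume ip u z / n`!%:R)%:E.
Proof.
elim: n u z => [|n IHn] u z ind zp.
  rewrite (_ : region ip u z = setT); last first.
    apply/seteqP; split => // t _; split; last by case.
    by exists (fun=> 0) => // -[].
  rewrite /vol /= /indic mem_set// /flag_volume (big_pred1 tt) => [|[]]//.
  by rewrite big_ord0 fact0 divr1.
rewrite (@vol_partition _ _ _ (pyramid u z) _ (pyramid_walls z)).
- under eq_bigr => i _.
    rewrite vol_pyramid// IHn; last exact: pseudocubical_proj; last exact: indep_proj.
    rewrite -EFinM.
    over.
  rewrite sumEFin flag_volumeS mulr_suml; congr EFin; apply: eq_bigr => i _.
  rewrite factS natrM; field.
  by rewrite !pnatr_eq0 -lt0n fact_gt0 nat1r pnatr_eq0.
- by move=> i; exact: coord_measurable_pyramid.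
- exact: coord_measurable_region.
- exact: coord_null_pyramid_walls.
- by move=> i j t; exact: pyramid_disjoint.
- by move=> i; exact: pyramid_sub.
- exact: region_sub_pyramids.
Qed.

End PyramidDecomposition.

(** * Generators and rays of polyhedral cones *)

Section Farkas.
Context {R : realType} {V : vectType R} (ip : {dot V for idfun}).
Implicit Types (s t : seq V) (C : set V).

Lemma conic_hull_comb (J : finType) s (a : J -> R) (y : J -> V) :
  (forall j, 0 <= a j) -> (forall j, y j \in s) ->
  conic_hull s (\sum_j a j *: y j).
Proof.
move=> a0 ys.
have ylt j : (index (y j) s < size s)%N by rewrite index_mem.
pose h j : 'I_(size s) := Ordinal (ylt j).
exists (fun i => \sum_(j | h j == i) a j).
  by move=> i; apply: sumr_ge0.
rewrite [RHS](partition_big h xpredT) //=; apply: eq_bigr => i _.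
rewrite scaler_suml; apply: eq_bigr => j /eqP <-.
by rewrite /= nth_index.
Qed.

Lemma conic_hullZ s a v : 0 <= a -> conic_hull s v -> conic_hull s (a *: v).
Proof.
move=> a0 [c c0 <-]; exists (fun i => a * c i); first by move=> i; exact: mulr_ge0.
by rewrite scaler_sumr; apply: eq_bigr => i _; rewrite scalerA.
Qed.

Lemma conic_hullD s v w : conic_hull s v -> conic_hull s w -> conic_hull s (v + w).
Proof.
move=> [c c0 <-] [d d0 <-]; exists (fun i => c i + d i).
  by move=> i; exact: addr_ge0.
by rewrite -big_split; apply: eq_bigr => i _; rewrite scalerDl.
Qed.

Lemma conic_hull0 s : conic_hull s 0.
Proof. by exists (fun=> 0) => //; apply: big1 => i _; rewrite scale0r. Qed.

Lemma conic_hull_mem s v : v \in s -> conic_hull s v.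
Proof.
move=> vs; rewrite -[v]scale1r -(big_ord1 +%R (fun=> 1 *: v)).
exact: (@conic_hull_comb _ s (fun=> 1) (fun=> v)).
Qed.

Lemma conic_hull_sum (J : Type) (r : seq J) (P : pred J) s (y : J -> V) :
  (forall j, P j -> conic_hull s (y j)) -> conic_hull s (\sum_(j <- r | P j) y j).
Proof.
move=> ys; elim/big_ind : _ => //; first exact: conic_hull0.
exact: conic_hullD.
Qed.

Lemma conic_hull_sub s t :
  (forall v, v \in s -> conic_hull t v) -> conic_hull s `<=` conic_hull t.
Proof.
move=> st _ [c c0 <-]; apply: conic_hull_sum => i _.
by apply: conic_hullZ => //; apply: st; exact: mem_nth.
Qed.

Lemma conic_hull_cons a s v : conic_hull (a :: s) v ->
  exists2 l, 0 <= l & exists2 w, conic_hull s w & v = l *: a + w.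
Proof.
move=> [c c0 <-]; exists (c ord0) => //.
exists (\sum_(i < size s) c (lift ord0 i) *: s`_i); last by rewrite big_ord_recl.
by exists (c \o lift ord0) => // i; exact: c0.
Qed.

Lemma dot_conic_hull s x v : (forall a, a \in s -> 0 <= ip x a) ->
  conic_hull s v -> 0 <= ip x v.
Proof.
move=> xs [c c0 <-]; rewrite linear_sumr; apply: sumr_ge0 => i _.
by rewrite [leRHS]dotZr mulr_ge0//; apply: xs; exact: mem_nth.
Qed.

(** Induction on the number of generators. If b is not already in the hull of [s], some y is
    nonnegative on [s] and negative at b, hence negative at [a]; normalized by y * a = -1, it allows
    [a] to be eliminated. *)
Lemma farkas s b :
  (forall x, (forall a, a \in s -> 0 <= ip x a) -> 0 <= ip x b) ->
  conic_hull s b.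
Proof.
have [n sn] := ubnP (size s); elim: n s b sn => // n IHn [|a s] b /=.
  move=> _ /(_ (- b)) => b0; suff -> : b = 0 by exact: conic_hull0.
  apply: (dot_eq0 (ip := ip)); apply/eqP; rewrite eq_le dot_ge0 andbT.
  rewrite -oppr_ge0; apply: le_trans (b0 _) _ => //.
  by rewrite -scaleN1r dotZl mulN1r.
rewrite ltnS => sn sb.
have [bs|] := pselect (forall x, (forall a, a \in s -> 0 <= ip x a) -> 0 <= ip x b).
  apply: conic_hull_sub (IHn _ _ sn bs) => v vs.
  by apply: conic_hull_mem; rewrite inE vs orbT.
move=> /existsNP[y0 /not_implyP[y0s y0b]].
have {}y0b : ip y0 b < 0 by rewrite ltNge; exact/negP.
have y0a : ip y0 a < 0.
  rewrite ltNge; apply/negP => y0a; have := sb y0; rewrite leNgt y0b => /(_ _)/negP.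
  by apply => // c; rewrite inE => /predU1P[->//|]; exact: y0s.
pose y := (- ip y0 a)^-1 *: y0.
have ya : ip y a = -1.
  by rewrite dotZl invrN mulNr mulVf// lt_eqF.
have k0 : 0 < (- ip y0 a)^-1 by rewrite invr_gt0 oppr_gt0.
have ys c : c \in s -> 0 <= ip y c.
  by move=> /y0s y0c; rewrite dotZl mulr_ge0// ltW.
have yb : ip y b <= 0 by rewrite dotZl mulr_ge0_le0// ltW.
(* The projection along [a] onto the orthogonal complement of y. *)
pose f c := c + ip y c *: a.
have : conic_hull (map f s) (f b).
  apply: IHn; first by rewrite size_map.
  move=> x xs.
  (* The vector x + (x * a) y is the pullback of x under [f]. It vanishes at [a], so the hypothesis
     on [a :: s] applies to it. *)
  have xE c : ip (x + ip x a *: y) c = ip x (f c).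
    by rewrite dotDl dotZl /f linearDr; congr (_ + _); rewrite [RHS]dotZr mulrC.
  rewrite -xE; apply: sb => c; rewrite inE => /predU1P[->|cs].
    by rewrite dotDl dotZl ya mulrN1 subrr.
  by rewrite xE; apply: xs; exact: map_f.
move=> [l]; rewrite /= => l0 lE.
have {}l0 : forall i, 0 <= l i by [].
have lts (i : 'I_(size (map f s))) : (i < size s)%N.
  by rewrite -[X in (_ < X)%N](size_map f).
(* Undoing the projection. The coefficient of [a] is nonnegative since y * c >= 0 on [s] and y * b
   <= 0. *)
rewrite (_ : b = (\sum_i l i * ip y s`_i - ip y b) *: a + \sum_(i < size (map f s)) l i *: s`_i).
  apply: conic_hullD.
    apply: conic_hullZ; last by apply: conic_hull_mem; rewrite mem_head.
    rewrite subr_ge0 (le_trans yb)//; apply: sumr_ge0 => i _.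
    by rewrite mulr_ge0// ys// mem_nth.
  apply: conic_hull_sum => i _; apply: conic_hullZ => //.
  apply: conic_hull_mem; by rewrite inE mem_nth ?orbT.
have : \sum_i l i *: (map f s)`_i =
    (\sum_i l i * ip y s`_i) *: a + \sum_i l i *: s`_i.
  rewrite scaler_suml -big_split; apply: eq_bigr => i _ /=.
  rewrite (nth_map 0)//.
  by rewrite /f scalerDr scalerA addrC.
rewrite lE /f => h; apply: (addIr (ip y b *: a)).
by rewrite h scalerBl addrAC subrK.
Qed.

End Farkas.

Section DotForm.
Context {R : realType} {V : vectType R} (ip : {dot V for idfun}).

(** Faces are cut out by bundled linear forms; this packages the product with a fixed vector as
    one. *)
Definition dot_form (v w : V) : R := ip v w.

Fact dot_form_is_scalar v : scalar (dot_form v).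
Proof. by move=> a x y; rewrite /dot_form dotC dotDl dotZl !(dotC ip _ v). Qed.

HB.instance Definition _ v :=
  GRing.isLinear.Build R V R *%R (dot_form v) (dot_form_is_scalar v).

Lemma dot_face x (C : set V) : (forall v, C v -> 0 <= ip x v) ->
  is_face (C `&` [set v | ip x v = 0]) C.
Proof. by move=> xC; exists (dot_form x : {scalar V}). Qed.

End DotForm.

Section Generators.
Context {R : realType} {V : vectType R} (ip : {dot V for idfun}).
Implicit Types (s t : seq V) (C : set V).

Lemma lin_span_conic s : lin_span (conic_hull s) = << s >>%VS.
Proof.
have [ls lm] := lin_spanP (conic_hull s).
apply/eqP; rewrite eqEsubv; apply/andP; split.
  apply: lm => v [c c0 <-] /=; apply: memv_suml => i _.
  by apply: memvZ; apply: memv_span; exact: mem_nth.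
by apply/span_subvP => v vs; exact/ls/conic_hull_mem.
Qed.

Lemma cone_dim_conic s : cone_dim (conic_hull s) = \dim << s >>.
Proof. by rewrite /cone_dim lin_span_conic. Qed.

Lemma conic_hull_remP a s : a \in s -> conic_hull s = conic_hull (a :: rem a s).
Proof.
move=> /perm_to_rem sp; apply/seteqP; split; apply: conic_hull_sub => v vs;
  apply: conic_hull_mem; by rewrite ?(perm_mem sp)// -(perm_mem sp).
Qed.

(** Take a generating list of minimal length. *)
Lemma exists_irredundant C : polyhedral_cone C ->
  exists2 s, C = conic_hull s & forall a, a \in s -> ~ conic_hull (rem a s) a.
Proof.
move=> [s0 Cs0].
pose p n := `[< exists2 s, C = conic_hull s & size s = n >].
have pex : exists n, p n by exists (size s0); apply/asboolP; exists s0.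
case: (ex_minnP pex) => n /asboolP[s Cs sn] nmin.
exists s => // a as_ ra.
have /nmin : p (size (rem a s)).
  apply/asboolP; exists (rem a s) => //; rewrite Cs (conic_hull_remP as_).
  apply/seteqP; split; apply: conic_hull_sub => v.
    by rewrite inE => /predU1P[->//|]; exact: conic_hull_mem.
  by move=> vs; apply: conic_hull_mem; rewrite inE vs orbT.
rewrite size_rem// -sn -ltnS prednK ?ltnn//.
by case: (s) as_.
Qed.

Lemma conic_hull1P (a v : V) : conic_hull [:: a] v <-> exists2 l, 0 <= l & v = l *: a.
Proof.
split=> [[c c0 <-]|[l l0 ->]].
  by exists (c ord0) => //; rewrite big_ord1.
by apply: conic_hullZ => //; apply: conic_hull_mem; rewrite mem_head.
Qed.

(* A generator that is not a combination of the others spans an exposed ray: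
   by Farkas' lemma, for every other generator b some linear form vanishes at a,
   is nonnegative on the cone and positive at b; sum these forms. *)
Lemma irredundant_ray s a : strongly_convex (conic_hull s) ->
  (forall b, b \in s -> ~ conic_hull (rem b s) b) -> a \in s ->
  rays (conic_hull s) (conic_hull [:: a]).
Proof.
move=> sc irr as_; have sE := conic_hull_remP as_.
have s0 b : b \in s -> b != 0.
  by move=> bs; apply/eqP => b0; apply: (irr b bs); rewrite b0; exact: conic_hull0.
have sep b : b \in rem a s -> exists x,
    [/\ ip x a = 0, forall c, c \in rem a s -> 0 <= ip x c & 0 < ip x b].
  move=> br; apply: contrapT => /forallNP nx.
  have : conic_hull (a :: - a :: rem a s) (- b).
    apply: (farkas (ip := ip)) => x xs; rewrite -scaleN1r dotZr mulN1r oppr_ge0.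
    rewrite leNgt; apply/negP => xb; apply: (nx x); split => // [|c cr].
      apply/eqP; rewrite eq_le xs ?mem_head// andbT -oppr_ge0.
      rewrite -mulN1r -dotZr scaleN1r; apply: xs.
      by rewrite !inE eqxx orbT.
    by apply: xs; rewrite !inE cr !orbT.
  move=> /conic_hull_cons[l l0 [w /conic_hull_cons[m m0 [w' w'r ->]]]] bE.
  (* If m - l > 0, then [a] is a combination of the other generators, against irredundancy.
     Otherwise -b lies in the cone together with b, against strong convexity. *)
  have {}bE : b + w' = (m - l) *: a.
    rewrite scalerBl -[b]opprK bE !opprD scalerN opprK.
    by rewrite -!addrA addNr addr0 addrC.
  have bw : conic_hull (rem a s) (b + w').
    by apply: conic_hullD => //; exact: conic_hull_mem.
  have [ml|ml] := ltP 0 (m - l).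
    apply: (irr a as_).
    have m0' : 0 <= (m - l)^-1 by rewrite invr_ge0 ltW.
    by have := conic_hullZ m0' bw; rewrite bE scalerA mulVf ?scale1r// gt_eqF.
  have bs : b \in s by exact: mem_rem br.
  have /eqP := s0 b bs; apply; apply: sc; first exact: conic_hull_mem.
  rewrite (_ : - b = w' + (l - m) *: a).
    apply: conic_hullD.
      by apply: conic_hull_sub w'r => v /mem_rem; exact: conic_hull_mem.
    by apply: conic_hullZ; [rewrite subr_ge0 -subr_le0|exact: conic_hull_mem].
  by rewrite -opprB scaleNr -bE opprD addrCA subrr addr0.
have [x xP] : exists x : V -> V, forall b, b \in rem a s ->
    [/\ ip (x b) a = 0, forall c, c \in rem a s -> 0 <= ip (x b) c & 0 < ip (x b) b].
  have /choice[x xP] (b : V) : exists y, b \in rem a s ->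
      [/\ ip y a = 0, forall c, c \in rem a s -> 0 <= ip y c & 0 < ip y b].
    by case: (boolP (b \in rem a s)) => [/sep[y yP]|_]; [exists y|exists 0].
  by exists x.
pose f := \sum_(b <- rem a s) x b.
have fE v : ip f v = \sum_(b <- rem a s) ip (x b) v by exact: linear_sumlz.
have fa : ip f a = 0 by rewrite fE big_seq big1// => b /xP[].
have fb b : b \in rem a s -> 0 < ip f b.
  move=> br; have [_ _ xb] := xP b br; rewrite fE (big_rem b)//=.
  by rewrite ltr_wpDr// big_seq sumr_ge0// => c /mem_rem/xP[_ + _]; exact.
have fs c : c \in s -> 0 <= ip f c.
  rewrite (perm_mem (perm_to_rem as_)) inE => /predU1P[->|/fb/ltW//].
  by rewrite fa.
split; last by rewrite cone_dim_conic span_seq1 dim_vline s0.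
rewrite (_ : conic_hull [:: a] = conic_hull s `&` [set v | ip f v = 0]).
  by apply: dot_face => v; apply: dot_conic_hull.
apply/seteqP; split => v.
  move=> /conic_hull1P[l l0 ->]; split; last by rewrite /= dotZr fa mulr0.
  by apply: conic_hullZ => //; exact: conic_hull_mem.
move=> [+ /= fv]; rewrite sE => /conic_hull_cons[l l0 [w [c c0 wE] vE]].
apply/conic_hull1P; exists l => //; rewrite vE (_ : w = 0) ?addr0//.
have : ip f w = 0.
  by move: fv; rewrite vE dotC dotDl dotZl !(dotC ip _ f) fa mulr0 add0r.
rewrite -wE linear_sumr => /eqP.
rewrite psumr_eq0; last first.
  move=> i _; rewrite [leRHS]dotZr mulr_ge0// ltW//; apply: fb; exact: mem_nth.
move=> /allP h; apply: big1 => i _; have /= := h i (mem_index_enum _).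
rewrite [X in X == _]dotZr mulf_eq0 (gt_eqF (fb _ (mem_nth _ _)))// orbF.
by move=> /eqP ->; rewrite scale0r.
Qed.

End Generators.

(** * Faces and rays of cones over independent families *)

Section Families.
Context {R : realType} {V : vectType R} (ip : {dot V for idfun}).
Implicit Types (C : set V).

Definition cone_fam n (u : 'I_n -> V) : set V :=
  [set comb u c | c in [set c : 'I_n -> R | forall i, 0 <= c i]].

(** Coefficients stay indexed by all generators, to match [vertex]; [sub_fam] reindexes the face so
    that the results on [cone_fam] apply to it. *)
Definition face_fam n (u : 'I_n -> V) (tau : {set 'I_n}) : set V :=
  [set comb u c | c in [set c : 'I_n -> R |
    (forall i, 0 <= c i) /\ forall i, i \notin tau -> c i = 0]].

Definition sub_fam n (u : 'I_n -> V) (tau : {set 'I_n}) : 'I_#|tau| -> V :=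
  u \o enum_val.

Section FamTheory.
Context {n : nat} (u : 'I_n -> V).

Lemma conic_hull_codom : conic_hull (codom u) = cone_fam u.
Proof.
apply/seteqP; split => [v|v [c c0 <-]]; last first.
  by apply: conic_hull_comb => // i; exact: codom_f.
move=> [c c0 <-]; elim/big_ind: _ => [|x y [a a0 <-] [b b0 <-]|i _].
- by exists (fun=> 0) => //; apply: big1 => i _; rewrite scale0r.
- by exists (fun i => a i + b i); [move=> i; exact: addr_ge0|rewrite combD].
- have /codomP[j ->] : (codom u)`_i \in codom u by exact: mem_nth.
  exists (fun k => if k == j then c i else 0) => [k|]; first by case: ifP.
  rewrite /comb (bigD1 j)//= eqxx big1 ?addr0// => k /negPf ->.
  by rewrite scale0r.
Qed.

Lemma indep_free : indep u -> free (codom u).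
Proof.
move=> ind; have sz : size (codom u) = n by rewrite size_codom card_ord.
have -> : codom u = [tuple of mktuple u] :> seq V.
  by rewrite /= /codom /image_mem; congr map; rewrite enumT.
apply/freeP => k k0; apply: ind; rewrite -[RHS]k0; apply: eq_bigr => i _.
by rewrite -tnth_nth tnth_mktuple.
Qed.

Lemma cone_dim_fam : indep u -> cone_dim (cone_fam u) = n.
Proof.
move=> /indep_free/eqP; rewrite -conic_hull_codom cone_dim_conic => ->.
by rewrite size_codom card_ord.
Qed.

Lemma lin_span_fam v : v \in lin_span (cone_fam u) <-> exists c, v = comb u c.
Proof.
rewrite -conic_hull_codom lin_span_conic; split; last first.
  by move=> [c ->]; apply: memv_suml => i _; apply/memvZ/memv_span/codom_f.
move=> /(@coord_span _ _ _ (in_tuple (codom u))) ->; elim/big_ind: _ => [|x y [a ->] [b ->]|i _].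
- by exists (fun=> 0); rewrite /comb big1// => i _; rewrite scale0r.
- by exists (fun i => a i + b i); rewrite combD.
- have /codomP[j jE] : (in_tuple (codom u))`_i \in codom u by apply: mem_nth; exact: ltn_ord.
  rewrite jE; exists (fun k => if k == j then coord (in_tuple (codom u)) i v else 0).
  rewrite /comb (bigD1 j)//= eqxx big1 ?addr0// => k /negPf ->.
  by rewrite scale0r.
Qed.

Lemma comb_sub_fam (tau : {set 'I_n}) c : (forall i, i \notin tau -> c i = 0) ->
  comb u c = comb (sub_fam u (tau := tau)) (c \o enum_val).
Proof.
move=> c0; rewrite /comb (bigID (mem tau))/= [X in _ + X]big1 ?addr0; last first.
  by move=> i it; rewrite c0// scale0r.
exact: big_enum_val.
Qed.

Lemma comb_sub_famP (tau : {set 'I_n}) (c : 'I_#|tau| -> R) :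
  exists d, [/\ forall i, i \notin tau -> d i = 0, forall k, d (enum_val k) = c k &
    comb (sub_fam u (tau := tau)) c = comb u d].
Proof.
pose d i := \sum_(k | enum_val k == i) c k.
have d0 i : i \notin tau -> d i = 0.
  move=> it; apply: big1 => k /eqP ki; have := enum_valP k.
  by rewrite ki (negPf it).
have dk k : d (enum_val k) = c k.
  by rewrite /d (big_pred1 k)// => l; rewrite (inj_eq enum_val_inj).
exists d; split => //; rewrite (comb_sub_fam d0).
by apply: eq_bigr => k _; rewrite /= dk.
Qed.

Lemma face_famE (tau : {set 'I_n}) : face_fam u tau = cone_fam (sub_fam u (tau := tau)).
Proof.
apply/seteqP; split => [_ [c [c0 ct] <-]|_ [c c0 <-]].
  by exists (c \o enum_val); [move=> k; exact: c0|rewrite (comb_sub_fam ct)].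
have [d [dt dk ->]] := comb_sub_famP c; exists d => //; split => // i.
have [it|it] := boolP (i \in tau); last by rewrite dt.
by rewrite -[i](enum_rankK_in it it) dk; exact: c0.
Qed.

Lemma indep_sub_fam (tau : {set 'I_n}) : indep u -> indep (sub_fam u (tau := tau)).
Proof.
move=> ind c; have [d [_ dk ->]] := comb_sub_famP c => /ind d0 k.
by rewrite -dk.
Qed.

(** The inverse Gram matrix provides x with x * u_j = 0 for j in [tau] and x * u_j = 1 otherwise; it
    exposes the face. *)
Lemma face_fam_face (tau : {set 'I_n}) : indep u -> is_face (face_fam u tau) (cone_fam u).
Proof.
move=> ind; have [A AE] := indep_inverse ip ind.
pose x := comb u (fun k => \sum_l (l \notin tau)%:R * A l k).
have xu j : ip x (u j) = (j \notin tau)%:R by exact: AE (fun l => (l \notin tau)%:R) j.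
have xc c : ip x (comb u c) = \sum_i c i * (i \notin tau)%:R.
  by rewrite dot_comb_comb; apply: eq_bigr => i _; rewrite xu.
rewrite (_ : face_fam u tau = cone_fam u `&` [set v | ip x v = 0]).
  apply: dot_face => _ [c c0 <-]; rewrite xc; apply: sumr_ge0 => i _.
  exact: mulr_ge0.
apply/seteqP; split => [_ [c [c0 ct] <-]|_ [[c c0 <-]]].
  split; first by exists c.
  rewrite /= xc big1// => i _; have [it|it] := boolP (i \in tau).
    by rewrite mulr0.
  by rewrite ct// mul0r.
rewrite /= xc => /eqP; rewrite psumr_eq0; last by move=> i _; exact: mulr_ge0.
move=> /allP h; exists c => //; split => // i it; apply/eqP.
by have /= := h i (mem_index_enum _); rewrite it mulr1.
Qed.

Lemma face_fam_set1 i : face_fam u [set i]%SET = conic_hull [:: u i].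
Proof.
apply/seteqP; split => [_ [c [c0 ct] <-]|v].
  apply/conic_hull1P; exists (c i) => //.
  by rewrite /comb (bigD1 i)//= big1 ?addr0// => j ji; rewrite ct ?scale0r// inE.
move=> /conic_hull1P[l l0 ->]; exists (fun j => if j == i then l else 0).
  by split => j; rewrite ?inE; [case: ifP|move/negPf ->].
by rewrite /comb (bigD1 i)//= eqxx big1 ?addr0// => j /negPf ->; rewrite scale0r.
Qed.

End FamTheory.

(** A face is spanned by the generators at which its form vanishes, and its dimension is their
    number, so a ray has exactly one. *)
Lemma rays_fam n (u : 'I_n -> V) : indep u -> rays (cone_fam u) = range (fun i => conic_hull [:: u i]).
Proof.
move=> ind; apply/seteqP; split => [F [[f f0 FE] F1]|_ [i _ <-]]; last first.
  rewrite -face_fam_set1; split; first exact: face_fam_face.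
  by rewrite face_famE cone_dim_fam ?cards1//; exact: indep_sub_fam.
pose tau := [set i | f (u i) == 0]%SET.
have fc c : f (comb u c) = \sum_i c i * f (u i).
  by rewrite linear_sum; apply: eq_bigr => i _; rewrite linearZ.
have fu i : 0 <= f (u i).
  apply: f0; rewrite -conic_hull_codom; exact/conic_hull_mem/codom_f.
have Ftau : F = face_fam u tau.
  rewrite FE; apply/seteqP; split => [_ [[c c0 <-]]|_ [c [c0 ct] <-]].
    rewrite /= fc => /eqP; rewrite psumr_eq0; last by move=> i _; exact: mulr_ge0.
    move=> /allP h; exists c => //; split => // i; rewrite inE => it.
    by have /= := h i (mem_index_enum _); rewrite mulf_eq0 (negPf it) orbF => /eqP.
  split; first by exists c.
  rewrite /= fc big1// => i _; have [|it] := boolP (i \in tau).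
    by rewrite inE => /eqP ->; rewrite mulr0.
  by rewrite ct// mul0r.
have /eqP/cards1P[i tauE] : #|tau| = 1%N.
  transitivity (cone_dim F); last exact: F1.
  by rewrite Ftau face_famE cone_dim_fam//; exact: indep_sub_fam.
by exists i => //; rewrite Ftau tauE face_fam_set1.
Qed.

End Families.

(** * From the cones of a simplicial fan to independent families *)

Section Frames.
Context {R : realType} {V : vectType R} (ip : {dot V for idfun}).
Implicit Types (C D : set V).

Lemma free_indep n (u : 'I_n -> V) : free (codom u) -> indep u.
Proof.
have -> : codom u = [tuple of mktuple u] :> seq V.
  by rewrite /= /codom /image_mem; congr map; rewrite enumT.
move=> /freeP fu c c0; apply: fu; rewrite -[RHS]c0; apply: eq_bigr => i _.
by rewrite -tnth_nth tnth_mktuple.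
Qed.

Lemma indep_ray_inj n (u : 'I_n -> V) i j : indep u ->
  conic_hull [:: u j] (u i) -> i = j.
Proof.
move=> ind /conic_hull1P[l _ uE]; apply/eqP; apply: contraT => ij.
have : comb u (fun k => (k == i)%:R - (k == j)%:R * l) = 0.
  rewrite combB /comb (bigD1 i)//= eqxx scale1r big1 ?addr0; last first.
    by move=> k /negPf ->; rewrite scale0r.
  rewrite (bigD1 j)//= eqxx mul1r -uE big1 ?addr0 ?subrr// => k /negPf ->.
  by rewrite mul0r scale0r.
move=> /ind/(_ i)/eqP; rewrite eqxx (negPf ij) mul0r subr0.
by rewrite oner_eq0.
Qed.

(** The enumeration is the one used in [dual_basis], so that generators and dual vectors correspond
    by position. *)
Definition ray_seq C : seq (set V) := enum_fset (fset_set (rays C)).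

Definition ray_at C (i : 'I_(size (ray_seq C))) : set V := nth set0 (ray_seq C) i.

Definition ray_fam (u : set V -> V) C i : V := u (ray_at (C := C) i).

Section Fan.
Context (d : nat) (Sigma : set (set V)) (u : set V -> V).
Context (fan : marked_fan d Sigma u) (simp : simplicial Sigma).

Lemma mem_ray_seq C rho : Sigma C -> (rho \in ray_seq C) = (rho \in rays C).
Proof.
move=> SC; rewrite -in_fset_set//.
by apply/finite_setP; exists (cone_dim C); exact: simp.
Qed.

Lemma size_ray_seq C : Sigma C -> size (ray_seq C) = cone_dim C.
Proof. by move=> SC; exact: card_fset_set (simp SC). Qed.

Lemma ray_atP C i : Sigma C -> rays C (ray_at (C := C) i).
Proof. by move=> SC; apply/set_mem; rewrite -mem_ray_seq// mem_nth. Qed.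

Lemma mark_ray C rho : Sigma C -> rays C rho -> rho (u rho) /\ u rho != 0.
Proof.
move=> SC [face dim1]; have [sf _ mk] := fan; apply: mk; split => //.
exact: fan_face sf _ _ SC face.
Qed.

(** Each irredundant generator spans a ray by [irredundant_ray], and the marked vector of that ray
    is a positive multiple of it. *)
Lemma ray_famE C : Sigma C -> conic_hull (codom (ray_fam u (C := C))) = C.
Proof.
move=> SC; have [sf _ _] := fan.
have [s CE irr] := exists_irredundant (fan_polyhedral sf SC).
have sc := fan_strongly_convex sf SC.
apply/seteqP; split.
  rewrite [X in _ `<=` X]CE; apply: conic_hull_sub => _ /codomP[i ->].
  rewrite -CE; have ri := ray_atP i SC.
  have [ui _] := mark_ray SC ri.
  by case: ri => -[f _ fE] _; rewrite /ray_fam; move: ui; rewrite {1}fE => -[].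
rewrite [X in X `<=` _]CE; apply: conic_hull_sub => a as_.
have ra : rays C (conic_hull [:: a]).
  by rewrite CE; apply: (irredundant_ray ip) => //; rewrite -CE.
have rs : conic_hull [:: a] \in ray_seq C by rewrite mem_ray_seq// inE.
have [/conic_hull1P[l l0 uE] u0] := mark_ray SC ra.
have ln0 : l != 0 by apply: contraNneq u0 => l0'; rewrite uE l0' scale0r.
have -> : a = l^-1 *: u (conic_hull [:: a]) by rewrite uE scalerA mulVf ?scale1r.
apply: conic_hullZ; first by rewrite invr_ge0.
apply: conic_hull_mem; apply/codomP.
have lt : (index (conic_hull [:: a]) (ray_seq C) < size (ray_seq C))%N.
  by rewrite index_mem.
by exists (Ordinal lt); rewrite /ray_fam /ray_at /= nth_index.
Qed.

(** The marked vectors span, and simpliciality makes their number the dimension of the span. *)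
Lemma indep_ray_fam C : Sigma C -> indep (ray_fam u (C := C)).
Proof.
move=> SC; apply: free_indep; rewrite /free -cone_dim_conic ray_famE//.
by rewrite size_codom card_ord size_ray_seq.
Qed.

Lemma cone_ray_fam C : Sigma C -> cone_fam (ray_fam u (C := C)) = C.
Proof. by move=> SC; rewrite -conic_hull_codom ray_famE. Qed.

Lemma ray_at_fam C i : Sigma C ->
  ray_at (C := C) i = conic_hull [:: ray_fam u i].
Proof.
move=> SC; have ri := ray_atP i SC; have ind := indep_ray_fam SC.
have [ui _] := mark_ray SC ri.
have := ri; rewrite -{1}(cone_ray_fam SC) (rays_fam ip ind) => -[j _ jE].
rewrite -jE; congr (conic_hull [:: ray_fam u _]); apply/esym.
by apply: (indep_ray_inj ind); rewrite jE.
Qed.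

Lemma cubical_vecP m (v : 'I_m -> V) D z : indep v -> D = cone_fam v ->
  (forall k, u (conic_hull [:: v k]) = v k) ->
  exists2 c, cubical_vec ip u D z = comb v c &
    forall k, ip (comb v c) (v k) = z (conic_hull [:: v k]).
Proof.
move=> ind DE uv; have [A AE] := indep_inverse ip ind.
pose zv k := z (conic_hull [:: v k]).
pose c0 := fun k => \sum_l zv l * A l k.
have [] : [set w | w \in lin_span D /\
    forall rho, rays D rho -> ip w (u rho) = z rho] (cubical_vec ip u D z).
  apply: xgetPex; exists (comb v c0); split.
    by rewrite DE; apply/lin_span_fam; exists c0.
  by move=> rho; rewrite DE (rays_fam ip ind) => -[k _ <-]; rewrite uv AE.
move=> ls lz; have {ls}/lin_span_fam[c cE] :
  cubical_vec ip u D z \in lin_span (cone_fam v) by rewrite -DE.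
exists c => // k; rewrite -cE -{1}uv; apply: lz.
by rewrite DE (rays_fam ip ind); exists k.
Qed.

Lemma face_ray_fam C tau : Sigma C -> Sigma (face_fam (ray_fam u (C := C)) tau).
Proof.
move=> SC; have [sf _ _] := fan; apply: (fan_face sf SC).
rewrite -[X in is_face _ X](cone_ray_fam SC); apply: (face_fam_face ip).
exact: indep_ray_fam.
Qed.

Lemma face_vertex C tau z : Sigma C ->
  let fam := ray_fam u (C := C) in
  exists2 c, vertex ip fam (fun i => z (ray_at i)) tau c &
    cubical_vec ip u (face_fam fam tau) z = comb fam c.
Proof.
move=> SC fam; have ind := indep_ray_fam SC.
have [k|c cE cz] := @cubical_vecP _ (sub_fam fam (tau := tau)) (face_fam fam tau) z
  (indep_sub_fam ind) (face_famE _ _).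
  by rewrite /sub_fam /= -ray_at_fam.
have [c' [c0 ck cc]] := comb_sub_famP fam c.
exists c'; last by rewrite cE cc.
split=> // i it; rewrite -cc.
have := cz (enum_rank_in it i); rewrite /sub_fam /= enum_rankK_in// => ->.
by rewrite -ray_at_fam.
Qed.

Lemma pseudoCub_ray_fam C z : Sigma C -> pseudoCub ip u Sigma z ->
  pseudocubical ip (ray_fam u (C := C)) (fun i => z (ray_at i)).
Proof.
move=> SC zp tau; have [c cv cE] := face_vertex tau z SC.
have ind := indep_ray_fam SC.
exists c => //; have := zp _ (face_ray_fam tau SC).
by rewrite cE => -[c' [c0 _] /(comb_inj ind) cc] i; rewrite -cc.
Qed.

(** If the coefficient at some i in [tau] were 0, a small step along -u_i would stay in the span of
    the face and in the ball, but leave the cone. *)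
Lemma Cub_ray_fam C z : Sigma C -> Cub ip u Sigma z ->
  cubical ip (ray_fam u (C := C)) (fun i => z (ray_at i)).
Proof.
move=> SC zp tau; have [c cv cE] := face_vertex tau z SC.
have ind := indep_ray_fam SC; set fam := ray_fam u (C := C) in cv cE ind *.
have := zp _ (face_ray_fam tau SC); rewrite cE => -[cF [e e0 eF]].
have c0 : forall i, 0 <= c i.
  by case: cF => c' [c0 _] /(comb_inj ind) cc i; rewrite -cc.
exists c => // i it; rewrite lt_neqAle c0 andbT eq_sym; apply/eqP => ci.
have ui := indep_gt0 ip i ind.
(* With this step length dl^2 |u_i|^2 <= 1 * e / 2 < e. *)
pose dl := Num.min 1 (e / (2 * ip (fam i) (fam i))).
have dl0 : 0 < dl by rewrite lt_min ltr01 divr_gt0// mulr_gt0.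
pose c' k := c k - (k == i)%:R * dl.
have c'E : comb fam c' = comb fam c - dl *: fam i.
  rewrite combB; congr (_ - _).
  rewrite /comb (bigD1 i)//= eqxx mul1r big1 ?addr0// => k /negPf ->.
  by rewrite mul0r scale0r.
have : face_fam fam tau (comb fam c').
  apply: eF.
    have c't k : k \notin tau -> c' k = 0.
      move=> kt; rewrite /c' cv.1//; case: eqP => [ki|_]; last by rewrite mul0r subr0.
      by rewrite ki it in kt.
    by rewrite face_famE; apply/lin_span_fam; exists (c' \o enum_val); exact: comb_sub_fam.
  rewrite c'E addrAC subrr add0r -scaleN1r dotZl dotZr dotZl dotZr.
  rewrite mulrA mulN1r opprK mul1r mulrA.
  apply: (@le_lt_trans _ _ (e / 2)); last by rewrite ltr_pdivrMr// ltr_pMr// ltr1n.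
  apply: (@le_trans _ _ (1 * (e / (2 * ip (fam i) (fam i))) * ip (fam i) (fam i))).
    rewrite ler_wpM2r ?(ltW ui)//; apply: ler_pM; rewrite ?(ltW dl0)//.
      by rewrite ge_min lexx.
    by rewrite ge_min lexx orbT.
  by rewrite mul1r invfM mulrA divfK ?gt_eqF.
move=> [c'' [c''0 _] /(comb_inj ind) /(_ i)].
rewrite /c' ci eqxx mul1r sub0r => h; have := c''0 i.
by rewrite h oppr_ge0 leNgt dl0.
Qed.

End Fan.
End Frames.

(** * Mixed volumes *)

Lemma sum_sign_supset (R : comNzRingType) (T : finType) (J : {set T}) :
  \sum_(I : {set T} | J \subset I) (-1) ^+ (#|T| - #|I|) =
    (J == finset.setT)%:R :> R.
Proof.
(* Expanding the product, I collects the factors 1 and its complement the factors -1, and a term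
   survives only if I contains J. As a product it is 0 unless J is everything. *)
transitivity (\prod_(i : T) (1 + - (i \notin J)%:R) : R).
  rewrite bigA_distr big_mkcond; apply: eq_bigr => I _.
  rewrite (bigID (mem I))/= [X in X * _]big1 ?mul1r => [|i ->//].
  rewrite (eq_bigr (fun i => - (i \notin J)%:R)) => [|i /negPf ->//].
  case: ifPn => [JI|/subsetPn[j jJ jI]].
    rewrite (eq_bigr (fun=> -1)) => [|i iI]; last first.
      by rewrite (contra (fintype.subsetP JI i) iI).
    rewrite prodr_const; congr (_ ^+ _).
    by rewrite -(cardC (mem I)) addKn; apply: eq_card => i; rewrite !inE.
  by rewrite (bigD1 j)//= jJ oppr0 mul0r.
have [->|] := eqVneq J finset.setT.
  by apply: big1 => i _; rewrite inE oppr0 addr0.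
rewrite -finset.subTset => /subsetPn[j _ jJ].
by rewrite (bigD1 j)//= jJ subrr mul0r.
Qed.

(** Ryser's formula for the permanent: after expansion the coefficient of g is the signed sum over
    the I containing its image, which [sum_sign_supset] evaluates. *)
Lemma ryser (R : comNzRingType) n (x : 'I_n -> 'I_n -> R) :
  \sum_(I : {set 'I_n}) (-1) ^+ (n - #|I|) * \prod_k \sum_(i in I) x k i =
  \sum_(g : {ffun 'I_n -> 'I_n} | injectiveb g) \prod_k x k (g k).
Proof.
under eq_bigr => I _ do rewrite bigA_distr_big_dep /= mulr_sumr.
rewrite (exchange_big_dep xpredT)//= [RHS]big_mkcond; apply: eq_bigr => g _.
rewrite -mulr_suml.
transitivity ((((g @: 'I_n)%SET == finset.setT)%:R : R) * \prod_k x k (g k)).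
  congr (_ * _); rewrite -sum_sign_supset card_ord; apply: eq_bigl => I.
  apply/familyP/fintype.subsetP => [gI _ /imsetP[k _ ->]|gI k]; first exact: gI.
  by apply: gI; exact: imset_f.
suff -> : ((g @: 'I_n)%SET == finset.setT) = injectiveb g.
  by case: injectiveb; rewrite ?mul1r ?mul0r.
rewrite finset.eqEcard finset.subsetT/= cardsT.
apply/idP/injectiveP => [gI|g_inj]; last by rewrite card_imset.
have /imset_injP g_inj : #|(g @: 'I_n)%SET| == #|'I_n|.
  by rewrite eqn_leq gI leq_imset_card.
by move=> i j; apply: g_inj.
Qed.

Section TruncatedCones.
Context {R : realType} {V : vectType R} (ip : {dot V for idfun}).

Definition truncated_fam n (u : 'I_n -> V) z : set V :=
  [set comb u c | c in [set c | (forall i, 0 <= c i) /\ truncated ip u z c]].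

Lemma truncated_fam_convex n (u : 'I_n -> V) z v w s : 0 <= s <= 1 ->
  truncated_fam u z v -> truncated_fam u z w ->
  truncated_fam u z (s *: v + (1 - s) *: w).
Proof.
move=> /andP[s0 s1] [c [c0 cz] <-] [d [d0 dz] <-].
exists (fun i => s * c i + (1 - s) * d i); last by rewrite combD !combZ.
split=> i; first by rewrite addr_ge0// mulr_ge0// subr_ge0.
rewrite combD !combZ dotDl !dotZl.
rewrite [leRHS](_ : _ = s * z i + (1 - s) * z i); last by ring.
by rewrite lerD// ler_wpM2l// subr_ge0.
Qed.

Lemma truncated_fam_vertex n (u : 'I_n -> V) z tau c : indep u ->
  pseudocubical ip u z -> vertex ip u z tau c -> truncated_fam u z (comb u c).
Proof.
move=> ind zp cv; exists c => //; split; last exact: vertex_le cv.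
by have [d dv d0] := zp tau => i; rewrite (vertex_uniq ind cv dv).
Qed.

Lemma truncated_fam_comb n (u : 'I_n -> V) z (J : finType) (a : J -> R) y :
  (forall j, 0 <= a j) -> \sum_j a j = 1 -> (forall j, truncated_fam u z (y j)) ->
  truncated_fam u z (\sum_j a j *: y j).
Proof.
move=> a0 a1 yP; have /choice[c cP] j : exists c,
    ((forall i, 0 <= c i) /\ truncated ip u z c) /\ comb u c = y j.
  by have [c [c0 ct] cy] := yP j; exists c.
exists (fun i => \sum_j a j * c j i); last first.
  rewrite comb_sum; apply: eq_bigr => j _; rewrite combZ.
  by have [_ ->] := cP j.
split=> i.
  by apply: sumr_ge0 => j _; rewrite mulr_ge0//; have [[]] := cP j.
rewrite comb_sum linear_sumlz -[leRHS]mul1r -a1 mulr_suml; apply: ler_sum => j _.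
rewrite combZ [leLHS]dotZl ler_wpM2l//; have [[_ +] _] := cP j; exact.
Qed.

Lemma convex_hull_convex (s : seq V) v w a : 0 <= a <= 1 ->
  convex_hull s v -> convex_hull s w -> convex_hull s (a *: v + (1 - a) *: w).
Proof.
move=> /andP[a0 a1] [c [c0 c1] <-] [e [e0 e1] <-].
exists (fun i => a * c i + (1 - a) * e i).
  split=> [i|]; first by rewrite addr_ge0// mulr_ge0// subr_ge0.
  by rewrite big_split/= -!mulr_sumr c1 e1 !mulr1 addrC subrK.
rewrite !scaler_sumr -big_split/=; apply: eq_bigr => i _.
by rewrite [LHS]scalerDl !scalerA.
Qed.

Lemma truncated_fam_polytope n (u : 'I_n -> V) z : indep u ->
  pseudocubical ip u z -> is_polytope (truncated_fam u z).
Proof.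
move=> ind zp; have /choice[w wP] (tau : {set 'I_n}) : exists c, vertex ip u z tau c.
  by have [c cv _] := zp tau; exists c.
pose s := [seq comb u (w tau) | tau : {set 'I_n}].
have ws tau : comb u (w tau) \in s by exact: codom_f.
exists s; first by apply/eqP => s0; have := ws finset.set0; rewrite s0.
apply/seteqP; split=> [_ [c [c0 cz] <-]|_ [a [a0 a1] <-]]; last first.
  apply: truncated_fam_comb => // i.
  have /codomP[tau ->] : s`_i \in s by exact: mem_nth.
  exact: truncated_fam_vertex (wP tau).
apply: (@truncated_hull _ _ ip n u z (fun c => convex_hull s (comb u c))) => //.
  move=> x y a a01 xs ys; rewrite combD !combZ; exact: convex_hull_convex.
move=> tau d dv; rewrite (_ : d = w tau); last exact/funext/(vertex_uniq ind dv).
rewrite -[comb u _]scale1r -(big_ord1 +%R (fun=> 1 *: comb u (w tau))).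
by apply: (@convex_hull_comb _ _ _ s (fun=> 1)) => //; rewrite big_ord1.
Qed.

(** The sum of the vectors w_tau for the z_j satisfies the equations of w_tau for the summed
    values. *)
Lemma pseudocubical_sum n (u : 'I_n -> V) (J : finType) (P : pred J)
    (z : J -> 'I_n -> R) :
  (forall j, pseudocubical ip u (z j)) ->
  pseudocubical ip u (fun i => \sum_(j | P j) z j i).
Proof.
move=> zp tau.
have /choice[c cP] j : exists c, vertex ip u (z j) tau c /\ forall i, 0 <= c i.
  by have [c cv c0] := zp j tau; exists c.
exists (fun i => \sum_(j | P j) c j i); last first.
  by move=> i; apply: sumr_ge0 => j _; have [_] := cP j.
split=> i it.
  by apply: big1 => j _; have [[+ _] _] := cP j; exact.
rewrite comb_sum linear_sumlz; apply: eq_bigr => j _.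
by have [[_ +] _] := cP j; exact.
Qed.

Lemma minkowski_truncated_fam n d (u : 'I_n -> V) (z : 'I_d -> 'I_n -> R)
    (I : {set 'I_d}) : indep u -> (forall i, pseudocubical ip u (z i)) ->
  minkowski_sum (fun i => truncated_fam u (z i)) I =
  truncated_fam u (fun k => \sum_(i in I) z i k).
Proof.
move=> ind zp; apply/seteqP; split.
  move=> _ [x xP <-].
  have /choice[c cP] i : exists c, i \in I ->
      [/\ forall k, 0 <= c k, truncated ip u (z i) c & comb u c = x i].
    have [/xP[c [c0 ct] cx]|_] := boolP (i \in I); first by exists c.
    by exists (fun=> 0).
  exists (fun k => \sum_(i in I) c i k); last first.
    by rewrite comb_sum; apply: eq_bigr => i /cP[].
  split=> k; first by apply: sumr_ge0 => i /cP[].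
  rewrite comb_sum linear_sumlz; apply: ler_sum => i /cP[_ ct _]; exact: ct.
move=> _ [c [c0 ct] <-]; pose P i := truncated_fam u (z i).
(* The Minkowski sum itself serves as the convex [K]: it contains each w_tau of the summed values as
   the sum of the individual w_tau. *)
apply: (truncated_hull (K := fun c => minkowski_sum P I (comb u c)) ind
  (pseudocubical_sum _ zp) _ _ c0 ct).
  move=> x y s s01 [v vP vx] [w wP wy].
  exists (fun i => s *: v i + (1 - s) *: w i).
    by move=> i iI; apply: truncated_fam_convex; [|exact: vP|exact: wP].
  by rewrite combD !combZ -vx -wy big_split/= !scaler_sumr.
move=> tau e ev.
have /choice[w wP] i : exists c, vertex ip u (z i) tau c.
  by have [c' cv _] := zp i tau; exists c'.
exists (fun i => comb u (w i)).
  by move=> i _; exact: truncated_fam_vertex (wP i).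
rewrite -comb_sum; congr comb; apply/funext/(vertex_uniq ind _ ev).
split=> k kt; first by apply: big1 => i _; have [+ _] := wP i; exact.
rewrite comb_sum linear_sumlz; apply: eq_bigr => i _.
by have [_ +] := wP i; exact.
Qed.

End TruncatedCones.

(** * Normalization by the fundamental simplex *)

Section StandardSimplex.
Context {R : realType}.
Local Notation TR := (measurableTypeR R).

Definition standard_simplex n : set ('I_n -> R) :=
  [set t | forall i, 0 <= t i] `&` [set t | \sum_i t i <= 1].

Lemma coord_measurable_box n (b : R) :
  coord_measurable [set t : 'I_n -> R | forall i, 0 <= t i <= b].
Proof.
rewrite (_ : [set t | _] =
    [set t | forall i, 0 <= t i] `&` [set t | forall i, t i <= b]).
  apply: coord_measurableI; apply: coord_measurable_forall => k.
    by apply: (@coord_measurable_le _ _ (fun=> 0)) => //; exact: measurable_tnth_R.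
  by apply: (@coord_measurable_le _ _ _ (fun=> b)) => //; exact: measurable_tnth_R.
apply/seteqP; split => [t tb|t [t0 tb] i]; last by rewrite t0 tb.
by split => i; have /andP[] := tb i.
Qed.

Lemma coord_measurable_simplex n : coord_measurable (@standard_simplex n).
Proof.
apply: coord_measurableI.
  apply: coord_measurable_forall => k.
  by apply: (@coord_measurable_le _ _ (fun=> 0)) => //; exact: measurable_tnth_R.
apply: (@coord_measurable_le _ _ _ (fun=> 1)) => //.
by apply: measurable_sum => k; exact: measurable_tnth_R.
Qed.

(** The simplex lies between two boxes. The outer one gives finiteness, without which [fine] would
    return 0; the inner one has side 1/(n+1), which is meaningful for n = 0 too. *)
Lemma vol_simplex_gt0 n : 0 < fine (vol (@standard_simplex n)).
Proof.
have mS := @coord_measurable_simplex n.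
have S1 : (vol (@standard_simplex n) <= 1%:E)%E.
  rewrite -[1](expr1n R n) -vol_box//.
  apply: le_vol => //; first exact: coord_measurable_box.
  move=> t [t0 ts] i; rewrite t0 /=; apply: le_trans ts.
  by rewrite (bigD1 i)//= lerDl sumr_ge0.
pose b : R := n.+1%:R^-1.
have b0 : 0 < b by rewrite invr_gt0.
have Sb : ((b ^+ n)%:E <= vol (@standard_simplex n))%E.
  rewrite -vol_box ?(ltW b0)//; apply: le_vol => //.
    exact: coord_measurable_box.
  move=> t tb; split=> [i|]; first by have /andP[] := tb i.
  apply: (@le_trans _ _ (\sum_(i < n) b)).
    by apply: ler_sum => i _; have /andP[] := tb i.
  rewrite sumr_const card_ord -mulr_natl /b ler_pdivrMr// mul1r ler_nat//.
rewrite -lte_fin fineK; last first.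
  by rewrite ge0_fin_numE ?vol_ge0//; exact: le_lt_trans S1 (ltry _).
by apply: lt_le_trans Sb; rewrite lte_fin exprn_gt0.
Qed.

Lemma coord_volumeE {V : vectType R} (b : seq V) n (A : set V) : size b = n ->
  coord_volume b A = fine (vol [set t : 'I_n -> R | A (\sum_i t i *: b`_i)]).
Proof. by move=> <-. Qed.

Lemma convex_hull_cons0 {V : vectType R} (b : seq V) n v : size b = n ->
  convex_hull (0 :: b) v <->
  exists2 t : 'I_n -> R, standard_simplex t & v = \sum_i t i *: b`_i.
Proof.
move=> <-; split.
  move=> [a [a0 a1] <-]; exists (a \o lift ord0).
    split=> [i|]; first exact: a0.
    by rewrite /= -a1 big_ord_recl lerDr.
  by rewrite /= big_ord_recl /= scaler0 add0r.
move=> [t [t0 t1] ->].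
exists (insert_at ord0 (1 - \sum_i t i) t).
  split=> [i|].
    have [j ->|->] := unliftP ord0 i; first by rewrite insert_at_lift; exact: t0.
    by rewrite insert_at_id subr_ge0.
  rewrite big_ord_recl insert_at_id.
  by rewrite [X in _ + X](eq_bigr t) => [|i _]; rewrite ?insert_at_lift ?subrK.
rewrite big_ord_recl /= scaler0 add0r.
by apply: eq_bigr => i _; rewrite insert_at_lift.
Qed.

End StandardSimplex.

Section FamVolume.
Context {R : realType} {V : vectType R} (ip : {dot V for idfun}).

Lemma vol_closed_region n (u : 'I_n -> V) z : indep u -> pseudocubical ip u z ->
  vol (cone_region ip u `&` [set t | forall j, t j <= z j]) =
  (flag_volume ip u z / n`!%:R)%:E.
Proof.
move=> ind zp; rewrite -vol_region//.
rewrite (@vol_partition _ _ 1 (fun=> region ip u z) _ [set t | exists i, t i = z i]).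
- by rewrite big_ord1.
- by move=> _; exact: coord_measurable_region.
- apply: coord_measurableI; first exact: coord_measurable_cone.
  apply: coord_measurable_forall => k.
  by apply: (@coord_measurable_le _ _ _ (fun=> z k)) => //; exact: measurable_tnth_R.
- by apply: coord_null_exists => i; exact: coord_null_hyperplane.
- by move=> i j t _ _; rewrite (ord1 i) (ord1 j).
- by move=> _ t [tc tz]; split=> // j; exact/ltW.
- move=> t [tc tz]; have [?|h] := pselect (exists i, t i = z i); [by right|left].
  exists ord0; split=> // j; rewrite /= lt_neqAle tz andbT.
  by apply/eqP => tj; apply: h; exists j.
Qed.

Lemma comb_dot_inj n (u : 'I_n -> V) c c' :
  (forall k, ip (comb u c) (u k) = ip (comb u c') (u k)) -> comb u c = comb u c'.
Proof.
move=> cc; apply/eqP; rewrite -subr_eq0 -combB; apply/eqP/(dot_eq0 (ip := ip)).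
rewrite dot_comb_comb big1// => k _.
by rewrite combB dotBl cc subrr mulr0.
Qed.

Section DualBasis.
Context {n : nat} (u : 'I_n -> V) (b : seq V) (bn : size b = n).
Context (bu : forall i : 'I_n, exists2 c, b`_i = comb u c &
  forall k, ip (comb u c) (u k) = (i == k)%:R).

(** Coordinates in the dual basis are the products with the u_k, so [coord_volume] measures the
    regions studied above. *)
Lemma dual_comb t : exists2 c, \sum_(i < n) t i *: b`_i = comb u c &
  forall k, ip (comb u c) (u k) = t k.
Proof.
have /choice[c cP] (i : 'I_n) : exists c, b`_i = comb u c /\
    forall k, ip (comb u c) (u k) = (i == k)%:R.
  by have [c cE ck] := bu i; exists c.
exists (fun k => \sum_i t i * c i k).
  by rewrite comb_sum; apply: eq_bigr => i _; rewrite combZ; have [-> _] := cP i.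
move=> k; rewrite comb_sum linear_sumlz (bigD1 k)//= big1 ?addr0 => [|i ik].
  by rewrite combZ [LHS]dotZl; have [_ ->] := cP k; rewrite eqxx mulr1.
by rewrite combZ [LHS]dotZl; have [_ ->] := cP i; rewrite (negPf ik) mulr0.
Qed.

Lemma coord_volume_truncated z : indep u -> pseudocubical ip u z ->
  coord_volume b (truncated_fam ip u z) = flag_volume ip u z / n`!%:R.
Proof.
move=> ind zp; rewrite (coord_volumeE _ bn).
rewrite (_ : [set t | _] = cone_region ip u `&` [set t | forall j, t j <= z j]).
  by rewrite vol_closed_region.
apply/seteqP; split => t /=; have [c -> ck] := dual_comb t.
  move=> [e [e0 ez] ec]; split; first by exists e => // j; rewrite ec ck.
  by move=> j; have := ez j; rewrite ec ck.
move=> [[e e0 te] tz]; exists e; last first.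
  by apply: comb_dot_inj => k; rewrite ck te.
by split=> // j; rewrite -te.
Qed.

Lemma coord_volume_simplex :
  coord_volume b (convex_hull (0 :: b)) = fine (vol (@standard_simplex R n)).
Proof.
rewrite (coord_volumeE _ bn); congr (fine (vol _)); apply/seteqP; split => t /=.
  move=> /(convex_hull_cons0 _ bn)[s ss].
  have [c -> ck] := dual_comb t; have [e -> ek] := dual_comb s => ce.
  by suff -> : t = s by []; apply/funext => k; rewrite -ck -ek ce.
by move=> ts; apply/(convex_hull_cons0 _ bn); exists t.
Qed.

End DualBasis.
End FamVolume.

(** Maximize the number of members of [F] contained in C. Purity speaks of maximal cones, so this
    yields a cone of dimension d. *)
Lemma finite_maximal (T : Type) (F : set (set T)) : finite_set F -> F !=set0 ->
  exists2 C, F C & forall D, F D -> C `<=` D -> D = C.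
Proof.
move=> Ffin [C0 FC0].
pose below C := fset_set [set E | F E /\ E `<=` C].
have bfin C : finite_set [set E | F E /\ E `<=` C].
  by apply: sub_finite_set Ffin => E [].
have belowE E C : (E \in below C) = `[< F E /\ E `<=` C >].
  by rewrite in_fset_set// inE.
pose p m := `[< exists2 C, F C & #|` below C| = m >].
have pex : exists m, p m by exists #|` below C0|; apply/asboolP; exists C0.
have pub m : p m -> (m <= #|` fset_set F|)%N.
  move=> /asboolP[C _ <-]; apply: fsubset_leq_card; apply/fsubsetP => E.
  by rewrite belowE in_fset_set// inE => /asboolP[].
case: (ex_maxnP pex pub) => m /asboolP[C FC Cm] mmax.
exists C => // D FD CD; apply: contrapT => DC.
have : p #|` below D| by apply/asboolP; exists D.
move=> /mmax; rewrite -Cm leqNgt => /negP; apply; apply: fproper_ltn_card.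
rewrite fproperEneq; apply/andP; split; last first.
  apply/fsubsetP => E; rewrite !belowE => /asboolP[FE EC].
  by apply/asboolP; split => //; exact: subset_trans CD.
apply/eqP => CDE; have : D \in below C by rewrite CDE belowE; apply/asboolP; split.
by rewrite belowE => /asboolP[_ DsubC]; apply: DC; apply/seteqP.
Qed.

Section ConeMixedVolume.
Context {R : realType} {V : vectType R} (ip : {dot V for idfun}).
Context (d : nat) (Sigma : set (set V)) (u : set V -> V).
Context (fan : marked_fan d Sigma u) (simp : simplicial Sigma).

Lemma truncated_coneE C z : Sigma C -> truncated_cone ip u C z =
  truncated_fam ip (ray_fam u (C := C)) (fun i => z (ray_at i)).
Proof.
move=> SC; have ind := indep_ray_fam ip fan simp SC.
have CE := cone_ray_fam ip fan simp SC.
apply/seteqP; split => v.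
  move=> [+ vz]; rewrite -{1}CE => -[c c0 cv]; exists c => //; split=> // i.
  by rewrite cv; apply: vz; exact: (ray_atP simp).
move=> [c [c0 ct] <-]; split; first by rewrite -[X in X _]CE; exists c.
move=> rho; rewrite -{1}CE (rays_fam ip ind) => -[i _ <-].
by rewrite -(ray_at_fam ip fan simp)//; exact: ct.
Qed.

Lemma size_dual_basis C : size (dual_basis ip u C) = size (ray_seq C).
Proof. by rewrite size_map. Qed.

Lemma dual_basisP C (i : 'I_(size (ray_seq C))) : Sigma C ->
  exists2 c, (dual_basis ip u C)`_i = comb (ray_fam u (C := C)) c &
    forall k, ip (comb (ray_fam u (C := C)) c) (ray_fam u k) = (i == k)%:R.
Proof.
move=> SC; have ind := indep_ray_fam ip fan simp SC.
have CE := cone_ray_fam ip fan simp SC.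
have [k|c cE ck] := @cubical_vecP R V ip u _ (ray_fam u (C := C)) C
  (\1_[set ray_at i]) ind (esym CE).
  by rewrite -(ray_at_fam ip fan simp).
exists c; first by rewrite (nth_map set0).
move=> k; rewrite ck -(ray_at_fam ip fan simp)// indicE in_set1.
by rewrite /ray_at nth_uniq// ?fset_uniq// eq_sym.
Qed.

Lemma cone_volume_truncated C z : Sigma C ->
  pseudocubical ip (ray_fam u (C := C)) z ->
  cone_volume ip u C (truncated_fam ip (ray_fam u (C := C)) z) =
  flag_volume ip (ray_fam u (C := C)) z / (size (ray_seq C))`!%:R /
    fine (vol (@standard_simplex R (size (ray_seq C)))).
Proof.
move=> SC zp; have ind := indep_ray_fam ip fan simp SC.
rewrite /cone_volume /normalized_volume.
rewrite (coord_volume_truncated (size_dual_basis C) (fun i => dual_basisP i SC))//.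
by rewrite (coord_volume_simplex (size_dual_basis C) (fun i => dual_basisP i SC)).
Qed.

(** A positive multiple of a sum of permanents, one for each flag. The arguments are indexed by the
    rays of C, so their number and the dimension coincide as terms. *)
Lemma MVol_coneE C (z : 'I_(size (ray_seq C)) -> set V -> R) : Sigma C ->
  (forall i, pseudoCub ip u Sigma (z i)) ->
  exists2 K : R, 0 < K &
  MVol_cone ip u C (fun i => truncated_cone ip u C (z i)) = K *
  \sum_(t : flag (size (ray_seq C))) \sum_(g : {ffun _ -> _} | injectiveb g)
    \prod_k flag_form ip (ray_fam u (C := C)) t k
      (fun i => z (g k) (ray_at i)).
Proof.
move=> SC zp; have ind := indep_ray_fam ip fan simp SC.
set fam := ray_fam u (C := C) in ind *.
set n := size (ray_seq C) in z zp fam ind *.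
pose zz i (k : 'I_n) := z i (ray_at k).
have zzp i : pseudocubical ip fam (zz i) by exact: (pseudoCub_ray_fam fan simp SC (zp i)).
rewrite (_ : (fun i => _) = fun i => truncated_fam ip fam (zz i)); last first.
  by apply/funext => i; exact: truncated_coneE.
have PU i : polytope_in (lin_span C) (truncated_fam ip fam (zz i)).
  split; first exact: truncated_fam_polytope.
  move=> _ [c _ <-] /=; rewrite -[X in lin_span X](cone_ray_fam ip fan simp SC).
  by apply/lin_span_fam; exists c.
have S0 := @vol_simplex_gt0 R n.
set S := fine _ in S0.
have f0 : 0 < n`!%:R :> R by rewrite ltr0n fact_gt0.
(* One factorial comes from polarization, the other from the volume of a region; [S] is the volume
   of the fundamental simplex. *)
exists (n`!%:R^-1 * (n`!%:R^-1 * S^-1)); first by rewrite !mulr_gt0 ?invr_gt0.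
rewrite /MVol_cone mixed_volumeE// /polarization -mulrA; congr (_ * _).
transitivity (\sum_(I : {set 'I_n}) (-1) ^+ (n - #|I|) *
   (flag_volume ip fam (fun k => \sum_(i in I) zz i k) / n`!%:R / S)).
  apply: eq_bigr => I _; congr (_ * _); rewrite minkowski_truncated_fam//.
  by rewrite cone_volume_truncated//; exact: pseudocubical_sum.
transitivity (n`!%:R^-1 * S^-1 * \sum_(t : flag n) \sum_(I : {set 'I_n})
   (-1) ^+ (n - #|I|) * \prod_k \sum_(i in I) flag_form ip fam t k (zz i)).
  rewrite exchange_big /= mulr_sumr; apply: eq_bigr => I _.
  rewrite -[X in _ = _ * X]mulr_sumr [RHS]mulrCA; congr (_ * _).
  rewrite -[LHS]mulrA [RHS]mulrC; congr (_ * _); apply: eq_bigr => t _; apply: eq_bigr => k _.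
  exact: flag_form_sum.
by congr (_ * _); apply: eq_bigr => t _; exact: ryser.
Qed.

Lemma MVol_cone_ge0 C m (z : 'I_m -> set V -> R) : Sigma C -> cone_dim C = m ->
  (forall i, pseudoCub ip u Sigma (z i)) ->
  0 <= MVol_cone ip u C (fun i => truncated_cone ip u C (z i)).
Proof.
move=> SC; rewrite -(size_ray_seq simp SC) => mE; subst m => zp.
have [K K0 ->] := MVol_coneE SC zp; have ind := indep_ray_fam ip fan simp SC.
rewrite mulr_ge0 ?(ltW K0)//; apply: sumr_ge0 => t _; apply: sumr_ge0 => g _.
apply: prodr_ge0 => k _; apply: flag_form_ge0 => //.
exact: (pseudoCub_ray_fam fan simp SC (zp _)).
Qed.

Lemma MVol_cone_gt0 C m (z : 'I_m -> set V -> R) : Sigma C -> cone_dim C = m ->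
  (forall i, Cub ip u Sigma (z i)) ->
  0 < MVol_cone ip u C (fun i => truncated_cone ip u C (z i)).
Proof.
move=> SC; rewrite -(size_ray_seq simp SC) => mE; subst m => zc.
have zp i : pseudoCub ip u Sigma (z i) by move=> D SD; have [] := zc i D SD.
have [K K0 ->] := MVol_coneE SC zp; have ind := indep_ray_fam ip fan simp SC.
have form_gt0 t k i : 0 < flag_form ip (ray_fam u (C := C)) t k
    (fun j => z i (ray_at j)).
  by apply: flag_form_gt0 => //; exact: (Cub_ray_fam fan simp SC (zc _)).
have sum_gt0 t : 0 < \sum_(g : {ffun _ -> _} | injectiveb g)
    \prod_k flag_form ip (ray_fam u (C := C)) t k (fun i => z (g k) (ray_at i)).
  (* The identity permutation supplies a strictly positive term. *)
  rewrite (bigD1 [ffun k => k])/=; last first.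
    by apply/injectiveP => k l; rewrite !ffunE.
  apply: ltr_pwDl; first by apply: prodr_gt0 => k _; exact: form_gt0.
  by apply: sumr_ge0 => g _; apply: prodr_ge0 => k _; exact/ltW/form_gt0.
rewrite mulr_gt0// (bigD1 (flag_inhabited _))//=.
by apply: ltr_pwDl => //; apply: sumr_ge0 => t _; exact/ltW.
Qed.

End ConeMixedVolume.

Theorem proposition3p5 (R : realType) (V : vectType R) (d : nat)
    (Sigma : set (set V)) (u : set V -> V)
    (ip : {dot V for idfun}) (omega : set V -> R) :
  marked_fan d Sigma u ->
  simplicial Sigma ->
  (forall C, cones Sigma d C -> 0 < omega C) ->
  (forall z : 'I_d -> set V -> R,
     (forall i, pseudoCub ip u Sigma (z i)) -> 0 <= MVol ip u Sigma omega z) /\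
  (forall z : 'I_d -> set V -> R,
     (forall i, Cub ip u Sigma (z i)) -> 0 < MVol ip u Sigma omega z).
Proof.
move=> fan simp om; have [sf pr _] := fan.
have cfin : finite_set (cones Sigma d).
  by apply: sub_finite_set (fan_finite sf) => C [].
split=> z zc.
  apply: fsumr_ge0 => C Cd; have [SC Cdim] := Cd.
  by rewrite mulr_ge0 ?(ltW (om _ Cd))//; exact: (MVol_cone_ge0 fan simp).
(* Strict positivity needs a nonempty sum: a maximal cone exists and has dimension d by purity. *)
have [C SC Cmax] := finite_maximal (fan_finite sf) (fan_nonempty sf).
have term_gt0 D : cones Sigma d D -> 0 < omega D *
    MVol_cone ip u D (fun i => truncated_cone ip u D (z i)).
  move=> Dd; have [SD Ddim] := Dd.
  by rewrite mulr_gt0 ?om//; exact: (MVol_cone_gt0 fan simp).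
have Cd : cones Sigma d C by split => //; exact: pr Cmax.
rewrite /MVol (fsbigD1 C)//=; apply: ltr_pwDl; first exact: term_gt0.
by apply: fsumr_ge0 => D [Dd _]; exact/ltW/term_gt0.
Qed.
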